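(* Consider either the multi-indexed Laguerre case (L) or the multi-indexed Jacobi case (J), with multi-index $\mathcal D$, integer $\mathcal N\ge1$, $\widetilde{\mathcal N}=\ell_{\mathcal D}+\mathcal N$, and the associated $\widetilde{\mathcal N}\times\widetilde{\mathcal N}$ matrix $\widetilde{\mathcal M}$ (defined in the context). For each $\mathcal D'\in\mathcal{EP}$, the eigenvalue of $\widetilde{\mathcal M}$ corresponding to the extra lower degree polynomial $P_{\mathcal D',\mathcal N}$, i.e. with eigenvector $\tilde{\rm v}^{\mathcal D'}_n=P_{\mathcal D',\mathcal N}(\eta_n)/\prod_{j\ne n}(\eta_n-\eta_j)$, $n=1,\dots,\widetilde{\mathcal N}$, is $\widetilde{\mathcal E}(\mathcal D')-\mathcal E(\mathcal N)$: $$\widetilde{\mathcal M}\,\tilde{\rm v}^{\mathcal D'}=\bigl(\widetilde{\mathcal E}(\mathcal D')-\mathcal E(\mathcal N)\bigr)\tilde{\rm v}^{\mathcal D'},$$ where - type I ($d_j^{\rm I}$ replaced by $\epsilon$): $\widetilde{\mathcal E}(\mathcal D')=\widetilde{\mathcal E}^{\rm I}(d_j^{\rm I})+\widetilde{\mathcal E}^{\rm I}(\epsilon)-\mathcal E(\mathcal N)$; - type II ($d_j^{\rm II}$ replaced by $\epsilon$): $\widetilde{\mathcal E}(\mathcal D')=\widetilde{\mathcal E}^{\rm II}(d_j^{\rm II})+\widetilde{\mathcal E}^{\rm II}(\epsilon)-\mathcal E(\mathcal N)$; - type III ($d_j^{\rm I}$ and $d_k^{\rm II}$ removed): $\widetilde{\mathcal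 E}(\mathcal D')=\widetilde{\mathcal E}^{\rm I}(d_j^{\rm I})+\widetilde{\mathcal E}^{\rm II}(d_k^{\rm II})-\mathcal E(\mathcal N)$. Moreover the coefficient $\mathcal E'(\mathcal D')$ in the identity $$\Xi_{\mathcal D}(\eta)\bigl(\widetilde{\mathcal H}_{\mathcal D}P_{\mathcal D',\mathcal N}(\eta)-\widetilde{\mathcal E}(\mathcal D')P_{\mathcal D',\mathcal N}(\eta)\bigr)=\mathcal E'(\mathcal D')P_{\mathcal D,\mathcal N}(\eta)\Xi_{\mathcal D'}(\eta)$$ is $2(\mathcal E(\mathcal N)-\widetilde{\mathcal E}^{\rm I}(\epsilon))$ for type I, $2(\mathcal E(\mathcal N)-\widetilde{\mathcal E}^{\rm II}(\epsilon))$ for type II, and, for type III, $-8$ in case L and $-32$ in case J.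
   Context: **Multi-index and parameters.** $\mathcal D=\mathcal D^{\rm I}\cup\mathcal D^{\rm II}$, $\mathcal D^{\rm I}=\{d_1^{\rm I}<\dots<d_M^{\rm I}\}$, $\mathcal D^{\rm II}=\{d_1^{\rm II}<\dots<d_N^{\rm II}\}$, positive integers, $M,N\ge0$, $M+N\ge1$ (the labels I and II are part of the data). Real parameters: $g$ in case L, with $g>\max\{N+\frac32,\,d_j^{\rm II}+\frac12\}$; $(g,h)$ in case J, with $g>\max\{N+2,\,d_j^{\rm II}+\frac12\}$, $h>\max\{M+2,\,d_j^{\rm I}+\frac12\}$. **Energies.** L: $\mathcal E(n)=4n$, $\widetilde{\mathcal E}^{\rm I}({\rm v})=-4(g+{\rm v}+\frac12)$, $\widetilde{\mathcal E}^{\rm II}({\rm v})=-4(g-{\rm v}-\frac12)$. J: $\mathcal E(n)=4n(n+g+h)$, $\widetilde{\mathcal E}^{\rm I}({\rm v})=-4(g+{\rm v}+\frac12)(h-{\rm v}-\frac12)$, $\widetilde{\mathcal E}^{\rm II}({\rm v})=-4(g-{\rm v}-\frac12)(h+{\rm v}+\frac12)$. **Polynomials.** $P_n=L_n^{(g-1/2)}$ (Laguerre, L), $P_n=P_n^{(g-1/2,h-1/2)}$ (Jacobi, J). For an integer ${\rm v}\ge 0$ put - L: $\mu^{\rm I}_{\rm v}(\eta)=e^{\eta}L^{(g-1/2)}_{\rm v}(-\eta)$, $\ \mu^{\rm II}_{\rm v}(\eta)=\eta^{1/2-g}L^{(1/2-g)}_{\rm v}(\eta)$; - J: $\mu^{\rm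 I}_{\rm v}(\eta)=\bigl(\frac{1+\eta}2\bigr)^{1/2-h}P^{(g-1/2,1/2-h)}_{\rm v}(\eta)$, $\ \mu^{\rm II}_{\rm v}(\eta)=\bigl(\frac{1-\eta}2\bigr)^{1/2-g}P^{(1/2-g,h-1/2)}_{\rm v}(\eta)$. ${\rm W}[f_1,\dots,f_r]=\det(d^{i-1}f_j/d\eta^{i-1})_{1\le i,j\le r}$ ($=1$ for $r=0$). For an index pair $\mathcal A=(a_1,\dots,a_p;b_1,\dots,b_q)$ (distinct non-negative integers $a_i$ of type I, distinct non-negative integers $b_i$ of type II) define the polynomials $$\Xi_{\mathcal A}(\eta)={\rm W}[\mu^{\rm I}_{a_1},\dots,\mu^{\rm I}_{a_p},\mu^{\rm II}_{b_1},\dots,\mu^{\rm II}_{b_q}]\times\begin{cases}\eta^{(p+g-\frac12)q}e^{-p\eta}&\text{L}\\ \bigl(\frac{1-\eta}2\bigr)^{(p+g-\frac12)q}\bigl(\frac{1+\eta}2\bigr)^{(q+h-\frac12)p}&\text{J}\end{cases}$$ $$P_{\mathcal A,n}(\eta)={\rm W}[\mu^{\rm I}_{a_1},\dots,\mu^{\rm I}_{a_p},\mu^{\rm II}_{b_1},\dots,\mu^{\rm II}_{b_q},P_n]\times\begin{cases}\eta^{(p+g+\frac12)q}e^{-p\eta}&\text{L}\\ \bigl(\frac{1-\eta}2\bigr)^{(p+g+\frac12)q}\bigl(\frac{1+\eta}2\bigr)^{(q+h+\frac12)p}&\text{J}\end{cases}$$ (formulas read on $0<\eta<\infty$ for L,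 $-1<\eta<1$ for J). $\mathcal D$ is identified with $(d^{\rm I}_1,\dots,d^{\rm I}_M;d^{\rm II}_1,\dots,d^{\rm II}_N)$, and $\ell_{\mathcal D}=\sum_j d_j^{\rm I}-\frac12M(M-1)+\sum_j d_j^{\rm II}-\frac12N(N-1)+MN$. **Differential operator.** $c_2(\eta)=\eta$ (L), $1-\eta^2$ (J). Put $c_1(\eta;g)=g+\frac12-\eta$ (L), $c_1(\eta;g,h)=h-g-(g+h+1)\eta$ (J). Let $C_1$ be $c_1$ with parameters shifted to $g+M-N$ (L), $(g+M-N,h-M+N)$ (J), and $C_1^-$ be $c_1$ with parameters $g+M-N-1$ (L), $(g+M-N-1,h-M+N-1)$ (J). Then $$\widetilde{\mathcal H}_{\mathcal D}=-4\Bigl(c_2\frac{d^2}{d\eta^2}+\Bigl(C_1-2c_2\frac{\Xi_{\mathcal D}'}{\Xi_{\mathcal D}}\Bigr)\frac{d}{d\eta}+c_2\frac{\Xi_{\mathcal D}''}{\Xi_{\mathcal D}}-C_1^-\frac{\Xi_{\mathcal D}'}{\Xi_{\mathcal D}}\Bigr).$$ **Matrix.** With $\eta_1,\dots,\eta_{\widetilde{\mathcal N}}$ the zeros of $P_{\mathcal D,\mathcal N}$, $$\widetilde{\mathcal M}_{nm}=\frac{\Bigl[\bigl(\widetilde{\mathcal H}_{\mathcal D}-\mathcal E(\mathcal N)\bigr)\prod_{j\ne m}(\eta-\eta_j)\Bigr]_{\eta=\eta_n}}{\prod_{j\ne n}(\eta_n-\eta_j)}.$$ **The set $\mathcal{EP}$**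 consists of the following $\ell_{\mathcal D}$ index pairs $\mathcal D'$: - type I: $\mathcal D$ with one entry $d_j^{\rm I}$ replaced (in the same position) by some integer $\epsilon$ with $0\le\epsilon<d_j^{\rm I}$, $\epsilon\notin\mathcal D^{\rm I}$; - type II: $\mathcal D$ with one entry $d_j^{\rm II}$ replaced (in the same position) by some integer $\epsilon$ with $0\le\epsilon<d_j^{\rm II}$, $\epsilon\notin\mathcal D^{\rm II}$; - type III: $\mathcal D$ with one entry $d_j^{\rm I}$ and one entry $d_k^{\rm II}$ both removed. **Standing assumption.** $P_{\mathcal D,\mathcal N}$ has degree exactly $\widetilde{\mathcal N}$, its zeros are pairwise distinct, none equals $0$ (L) or $\pm1$ (J), and none is a zero of $\Xi_{\mathcal D}$. *)

(* Defs.v *)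
From mathcomp Require Import all_boot all_order all_algebra.
From mathcomp Require Import all_classical all_reals all_analysis.
From mathcomp Require Import complex.

Set Implicit Arguments.
Unset Strict Implicit.
Unset Printing Implicit Defensive.

Import Order.TTheory GRing.Theory Num.Theory.
Import numFieldNormedType.Exports.

Local Open Scope classical_set_scope.
Local Open Scope ring_scope.

Definition pochhammer (F : nzRingType) (a : F) (n : nat) : F :=
  \prod_(i < n) (a + i%:R).

(* sum_k (-1)^k binom(n + al, n - k) x^k / k!, valid for every real [al]. *)
Definition laguerre (F : fieldType) (al : F) (n : nat) : {poly F} :=
  \sum_(k < n.+1)
    ((-1) ^+ k * pochhammer (al + k%:R + 1) (n - k)
       / ((n - k)`!%:R * k`!%:R)) *: 'X^k.

(* (al + 1)_n / n! * 2F1(-n, n + al + be + 1; al + 1; (1 - x) / 2), with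
   (al + 1)_n / (al + 1)_k written as (al + k + 1)_(n - k) so that [al] may be
   a negative integer. *)
Definition jacobi (F : fieldType) (al be : F) (n : nat) : {poly F} :=
  \sum_(k < n.+1)
    (pochhammer (- n%:R) k * pochhammer (n%:R + al + be + 1) k
       * pochhammer (al + k%:R + 1) (n - k) / (n`!%:R * k`!%:R))
    *: (2%:R^-1 *: (1 - 'X)) ^+ k.

Definition wronskian (R : realType) (fs : seq (R -> R)) (x : R) : R :=
  \det (\matrix_(i < size fs, j < size fs)
          derive1n i (nth (fun=> 0) fs j) x).

(* The polynomial that coincides with [f] on [D] (unique when [D] is infinite);
   0 when there is none. *)
Definition poly_on (R : realType) (D : set R) (f : R -> R) : {poly R} :=
  xget 0 [set p : {poly R} | forall x, D x -> p.[x] = f x].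

Variant system (R : Type) := Laguerre (g : R) | Jacobi (g h : R).

Record index_pair := IndexPair { idxI : seq nat ; idxII : seq nat }.

Definition multi_index (D : index_pair) : bool :=
  [&& sorted ltn (idxI D), sorted ltn (idxII D), all (ltn 0) (idxI D),
      all (ltn 0) (idxII D) & 0 < size (idxI D) + size (idxII D)]%N.

Definition ell (D : index_pair) : nat :=
  let M := size (idxI D) in let N := size (idxII D) in
  (sumn (idxI D) - (M * M.-1)./2 + (sumn (idxII D) - (N * N.-1)./2) + M * N)%N.

Section Systems.
Variable R : realType.
Implicit Types (s : system R) (A D : index_pair).

Local Notation half := (2%:R^-1 : R).

Definition admissible s D : Prop :=
  let M := (size (idxI D))%:R in let N := (size (idxII D))%:R in
  match s with
  | Laguerre g =>
      N + 3%:R / 2%:R < g /\ {in idxII D, forall d : nat, d%:R + half < g}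
  | Jacobi g h =>
      [/\ N + 2%:R < g, {in idxII D, forall d : nat, d%:R + half < g},
          M + 2%:R < h & {in idxI D, forall d : nat, d%:R + half < h}]
  end.

Definition domain s : set R :=
  match s with
  | Laguerre _ => [set x | 0 < x]
  | Jacobi _ _ => [set x | -1 < x < 1]
  end.

Definition energy s (n : nat) : R :=
  match s with
  | Laguerre _ => 4%:R * n%:R
  | Jacobi g h => 4%:R * n%:R * (n%:R + g + h)
  end.

Definition energyI s (v : nat) : R :=
  match s with
  | Laguerre g => - 4%:R * (g + v%:R + half)
  | Jacobi g h => - 4%:R * (g + v%:R + half) * (h - v%:R - half)
  end.

Definition energyII s (v : nat) : R :=
  match s with
  | Laguerre g => - 4%:R * (g - v%:R - half)
  | Jacobi g h => - 4%:R * (g - v%:R - half) * (h + v%:R + half)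
  end.

Definition base_poly s (n : nat) : {poly R} :=
  match s with
  | Laguerre g => laguerre (g - half) n
  | Jacobi g h => jacobi (g - half) (h - half) n
  end.

Definition muI s (v : nat) (x : R) : R :=
  match s with
  | Laguerre g => expR x * (laguerre (g - half) v).[- x]
  | Jacobi g h =>
      ((1 + x) / 2%:R) `^ (half - h) * (jacobi (g - half) (half - h) v).[x]
  end.

Definition muII s (v : nat) (x : R) : R :=
  match s with
  | Laguerre g => x `^ (half - g) * (laguerre (half - g) v).[x]
  | Jacobi g h =>
      ((1 - x) / 2%:R) `^ (half - g) * (jacobi (half - g) (h - half) v).[x]
  end.

Definition seeds s A : seq (R -> R) :=
  map (muI s) (idxI A) ++ map (muII s) (idxII A).

Definition Xi_factor s A (x : R) : R :=
  let p := (size (idxI A))%:R in let q := (size (idxII A))%:R in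
  match s with
  | Laguerre g => x `^ ((p + g - half) * q) * expR (- p * x)
  | Jacobi g h => ((1 - x) / 2%:R) `^ ((p + g - half) * q)
                  * ((1 + x) / 2%:R) `^ ((q + h - half) * p)
  end.

Definition P_factor s A (x : R) : R :=
  let p := (size (idxI A))%:R in let q := (size (idxII A))%:R in
  match s with
  | Laguerre g => x `^ ((p + g + half) * q) * expR (- p * x)
  | Jacobi g h => ((1 - x) / 2%:R) `^ ((p + g + half) * q)
                  * ((1 + x) / 2%:R) `^ ((q + h + half) * p)
  end.

Definition Xi s A : {poly R} :=
  poly_on (domain s) (fun x => wronskian (seeds s A) x * Xi_factor s A x).

Definition P_poly s A (n : nat) : {poly R} :=
  poly_on (domain s)
    (fun x => wronskian (rcons (seeds s A) (horner (base_poly s n))) x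
              * P_factor s A x).

Definition shift_params s (a b : R) : system R :=
  match s with
  | Laguerre g => Laguerre (g + a)
  | Jacobi g h => Jacobi (g + a) (h + b)
  end.

Definition c2 s : {poly R} :=
  match s with
  | Laguerre _ => 'X
  | Jacobi _ _ => 1 - 'X^2
  end.

Definition c1 s : {poly R} :=
  match s with
  | Laguerre g => (g + half)%:P - 'X
  | Jacobi g h => (h - g)%:P - (g + h + 1) *: 'X
  end.

(* The zeros of [P_poly s D n] may be non-real, so real polynomials and constants
   are evaluated over the complex numbers from here on. *)
Definition evalC (p : {poly R}) (x : R[i]) : R[i] :=
  (map_poly (real_complex R) p).[x].

(* Meaningful at the points [x] where [Xi s D] does not vanish. *)
Definition Htilde s D (f : {poly R[i]}) (x : R[i]) : R[i] :=
  let k : R := (size (idxI D))%:R - (size (idxII D))%:R in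
  let X0 := evalC (Xi s D) x in
  let X1 := evalC (Xi s D)^`() x in
  let X2 := evalC (Xi s D)^`(2) x in
  let C2 := evalC (c2 s) x in
  let C1 := evalC (c1 (shift_params s k (- k))) x in
  let C1m := evalC (c1 (shift_params s (k - 1) (- k - 1))) x in
  - 4%:R * (C2 * f^`(2).[x] + (C1 - 2%:R * C2 * (X1 / X0)) * f^`().[x]
            + (C2 * (X2 / X0) - C1m * (X1 / X0)) * f.[x]).

Definition Mtilde s D (n : nat) (r : nat) (eta : 'I_r -> R[i]) : 'M[R[i]]_r :=
  \matrix_(i < r, m < r)
    let f : {poly R[i]} := \prod_(j < r | j != m) ('X - (eta j)%:P) in
    (Htilde s D f (eta i) - real_complex R (energy s n) * f.[eta i])
    / \prod_(j < r | j != i) (eta i - eta j).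

Definition eigvec (p : {poly R}) (r : nat) (eta : 'I_r -> R[i]) : 'cV[R[i]]_r :=
  \col_(i < r) (evalC p (eta i) / \prod_(j < r | j != i) (eta i - eta j)).

Definition special_point s (x : R[i]) : bool :=
  match s with
  | Laguerre _ => x == 0
  | Jacobi _ _ => (x == 1) || (x == -1)
  end.

Definition generic_zeros s D (n : nat) (r : nat) (eta : 'I_r -> R[i]) : Prop :=
  [/\ size (P_poly s D n) = r.+1, injective eta &
      forall i, [/\ evalC (P_poly s D n) (eta i) = 0, ~~ special_point s (eta i)
                  & evalC (Xi s D) (eta i) != 0]].

(* Positions [j], [k] are counted from 0. *)
Variant ep_move :=
  | ReplaceI (j eps : nat)
  | ReplaceII (j eps : nat)
  | RemoveIII (j k : nat).

(* Membership in EP, whose elements are the [target D m]. *)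
Definition in_EP D (m : ep_move) : bool :=
  match m with
  | ReplaceI j eps => [&& j < size (idxI D), eps < nth 0 (idxI D) j
                        & eps \notin idxI D]
  | ReplaceII j eps => [&& j < size (idxII D), eps < nth 0 (idxII D) j
                         & eps \notin idxII D]
  | RemoveIII j k => (j < size (idxI D)) && (k < size (idxII D))
  end%N.

Definition delete_at (j : nat) (t : seq nat) : seq nat :=
  take j t ++ drop j.+1 t.

Definition target D (m : ep_move) : index_pair :=
  match m with
  | ReplaceI j eps => IndexPair (set_nth 0%N (idxI D) j eps) (idxII D)
  | ReplaceII j eps => IndexPair (idxI D) (set_nth 0%N (idxII D) j eps)
  | RemoveIII j k => IndexPair (delete_at j (idxI D)) (delete_at k (idxII D))
  end.

Definition energyEP s D (n : nat) (m : ep_move) : R :=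
  match m with
  | ReplaceI j eps =>
      energyI s (nth 0%N (idxI D) j) + energyI s eps - energy s n
  | ReplaceII j eps =>
      energyII s (nth 0%N (idxII D) j) + energyII s eps - energy s n
  | RemoveIII j k =>
      energyI s (nth 0%N (idxI D) j) + energyII s (nth 0%N (idxII D) k)
      - energy s n
  end.

Definition coefEP s (n : nat) (m : ep_move) : R :=
  match m with
  | ReplaceI _ eps => 2%:R * (energy s n - energyI s eps)
  | ReplaceII _ eps => 2%:R * (energy s n - energyII s eps)
  | RemoveIII _ _ =>
      match s with Laguerre _ => - 8%:R | Jacobi _ _ => - 32%:R end
  end.

End Systems.

(* Main.v *)
From HB Require Import structures.
Require Import Defs.
From mathcomp Require Import all_boot all_order all_algebra.
From mathcomp Require Import all_classical all_reals all_analysis.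
From mathcomp Require Import complex.
From mathcomp Require Import perm generic_quotient fraction ring lra zify.

(** Write a seed function as [theta * u], where [theta' / theta] is rational and
    [u] is a polynomial, and keep only the pair [(theta' / theta, u)]: Wronskians
    then live in the field of rational functions. Row operations give
    [W(f :: l) = f * W(T l)] for the Darboux transformation [T g = g' - (f' / f) g],
    which maps the eigenfunctions of [c D^2 + b D + v] to those of an operator of
    the same kind. In the type I and II moves the unchanged seeds come first, and
    both sides of the identity are ratios of Wronskians that do not change when the
    leading seed is absorbed into the operator, so only an identity between three
    eigenfunctions remains; type III is similar. Expanding the determinants
    multilinearly gives the polynomiality of [Xi] and [P_poly] together with the
    degree bound, and the eigenvector equation follows by Lagrange interpolation at
    the zeros. *)

Set Implicit Arguments.
Unset Strict Implicit.
Unset Printing Implicit Defensive.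

Import Order.TTheory GRing.Theory Num.Theory.
Import numFieldNormedType.Exports.
Local Open Scope ring_scope.

(** * Twisted Wronskians and Darboux transformations *)

(** [Htilde] carries a factor [-4], so energies enter as eigenvalues [E / 4] of one second order
    operator shared by the seeds of both types and by [base_poly]. Let [f] be the seed that leaves,
    [g] the seed that enters and [h] the function [base_poly s n]. The target is not an
    eigenfunction: eliminating second derivatives from [W(g, h) / f] produces the value
    [lf + lg - lh] and a remainder proportional to [W(f, h) * g]. Leading seeds can be absorbed
    because the potential after several Darboux steps depends on them only through the
    log-derivative of their Wronskian, which is additive along the chain. It remains to recognise
    [Htilde]. The ratio of Wronskians differs from [P_poly / Xi] by powers of the two factors of
    [c2], and conjugating by these powers produces the shifted coefficients [C1] and [C1m]. The
    constants in [(1 + x) / 2] and [(1 - x) / 2] cancel when the numbers of seeds are preserved, but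
    leave [normal s ^+ 2] in type III, whence [-4 * 2 * 1 = -8] and [-4 * 2 * 4 = -32]. *)

HB.lock Definition twisted_deriv (K : fieldType) (d : {additive K -> K}) (w u : K) : K :=
  d u + w * u.

Section TwistedWronskian.
Variables (K : fieldType) (d : {additive K -> K}).
Hypothesis dM : forall x y, d (x * y) = d x * y + x * d y.
Local Notation td := (twisted_deriv d).

(** If [d theta = w * theta], then [td w u] is [theta^-1 * d (theta * u)]. So this is the Wronskian
    of the functions [theta_j * u_j] divided by the product of the [theta_j]. *)
Definition twisted_wronskian (l : seq (K * K)) : K :=
  \det (\matrix_(i < size l, j < size l)
          iter i (td (nth (0, 0) l j).1) (nth (0, 0) l j).2).
Local Notation Wr := twisted_wronskian.

(** [td f.1 f.2 / f.2] is the full log-derivative of [f], weight included. It lies in [K], so the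
    transformed function keeps the twist of [g]. *)
Definition darboux (f g : K * K) : K * K :=
  (g.1, td g.1 g.2 - td f.1 f.2 / f.2 * g.2).

Lemma tdE w u : td w u = d u + w * u.
Proof. by rewrite twisted_deriv.unlock. Qed.

Lemma deriv1 : d 1 = 0.
Proof. by apply: (addrI (d 1)); rewrite addr0 -[in RHS](mulr1 1) dM mul1r mulr1. Qed.

Lemma derivV x : x != 0 -> d x^-1 = - d x / x ^+ 2.
Proof.
move=> x0; apply: (mulfI x0); apply: (addrI (d x / x)).
by rewrite -dM divff// deriv1; field.
Qed.

Lemma td_is_additive w : zmod_morphism (td w).
Proof. by move=> x y; rewrite !tdE raddfB/=; ring. Qed.

HB.instance Definition _ w := GRing.isZmodMorphism.Build K K (td w) (td_is_additive w).

Lemma tdM w1 w2 u1 u2 : td (w1 + w2) (u1 * u2) = td w1 u1 * u2 + u1 * td w2 u2.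
Proof. by rewrite !tdE dM; ring. Qed.

Lemma tdZ w u1 u2 : td w (u1 * u2) = d u1 * u2 + u1 * td w u2.
Proof. by rewrite !tdE dM; ring. Qed.

Lemma td_div w1 w2 u1 u2 : u2 != 0 ->
  td (w1 - w2) (u1 / u2) = (td w1 u1 * u2 - u1 * td w2 u2) / u2 ^+ 2.
Proof. by move=> h; rewrite !tdE dM derivV//; field. Qed.

Lemma twisted_wronskianE n l : size l = n ->
  Wr l = \det (\matrix_(i < n, j < n)
          iter i (td (nth (0, 0) l j).1) (nth (0, 0) l j).2).
Proof. by move<-. Qed.

(* Coefficients of the operator [D^i (D - a)] in terms of the powers of [D]. *)
Fixpoint shift_coef (a : K) (i k : nat) : K :=
  match i with
  | 0 => if k is k'.+1 then (k' == 0)%:R else - a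
  | i'.+1 => d (shift_coef a i' k)
             + (if k is k'.+1 then shift_coef a i' k' else 0)
  end.

Lemma shift_coef_gt a i k : (i.+1 < k)%N -> shift_coef a i k = 0.
Proof.
elim: i k => [|i IH] [|k]//= ik; first by case: k ik.
by rewrite !IH ?raddf0 ?addr0//; lia.
Qed.

Lemma shift_coefS a i : shift_coef a i i.+1 = 1.
Proof. by elim: i => [|i IH]//=; rewrite IH shift_coef_gt// raddf0 add0r. Qed.

Lemma shift_coefE a i N w u : (i.+1 < N)%N ->
  \sum_(k < N) shift_coef a i k * iter k (td w) u = iter i (td w) (td w u - a * u).
Proof.
elim: i N => [|i IH] N.
  case: N => [|[|N]]// _; rewrite !big_ord_recl big1/=; first by ring.
  by move=> k _; rewrite /= mul0r.
move=> iN; rewrite iterS -(IH N) ?(ltnW iN)//.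
rewrite raddf_sum/=; under [RHS]eq_bigr do rewrite tdZ.
rewrite [RHS]big_split/=; under eq_bigr do rewrite mulrDl.
rewrite big_split/=; congr (_ + _).
case: N iN => // N iN; rewrite big_ord_recl big_ord_recr/= mul0r add0r.
by rewrite (@shift_coef_gt a i N) ?mul0r ?addr0//; lia.
Qed.

Lemma twisted_wronskian_cons f l : f.2 != 0 ->
  Wr (f :: l) = f.2 * Wr (map (darboux f) l).
Proof.
move=> f0; set n := size l; set a := td f.1 f.2 / f.2.
have szD : size (map (darboux f) l) = n by rewrite size_map.
rewrite (twisted_wronskianE szD) /twisted_wronskian/= -/n.
set A := (\matrix_(_, _) _).
(* Row 0 keeps the functions and row [i + 1] applies [D^i (D - a)]. These operators are monic, so
   [L] is unitriangular, and [(D - a) f = 0] clears the first column below its top entry. *)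
pose L : 'M[K]_n.+1 := \matrix_(i, k)
  (if i : nat is i'.+1 then shift_coef a i' k else (k == 0)%:R).
have detL : \det L = 1.
  rewrite det_trig ?big1// => [i _|]; rewrite ?mxE.
    by case: i => -[|i] ii/=; rewrite ?shift_coefS.
  apply/is_trig_mxP => -[i ii] [k kk] /= ik; rewrite mxE/=.
  by case: i ii ik => [|i] ii ik; [case: k kk ik|rewrite shift_coef_gt].
rewrite -[LHS]mul1r -detL -det_mulmx.
have LA i (j : 'I_n.+1) : (L *m A) (lift ord0 i) j =
    iter i (td (nth (0,0) (f :: l) j).1)
      (td (nth (0,0) (f :: l) j).1 (nth (0,0) (f :: l) j).2 - a * (nth (0,0) (f :: l) j).2).
  rewrite mxE -(@shift_coefE a i n.+1) ?ltnS//.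
  by apply: eq_bigr => k _; rewrite !mxE.
rewrite (expand_det_col (L *m A) ord0) big_ord_recl big1 ?addr0; last first.
  move=> i _; rewrite LA/= /a divfK// subrr.
  have -> : iter i (td f.1) 0 = 0 by elim: (nat_of_ord i) => //= k ->; rewrite raddf0.
  by rewrite mul0r.
congr (_ * _).
  rewrite mxE big_ord_recl big1 ?addr0 => [|k _]; rewrite !mxE/= ?mul1r//.
  by rewrite mul0r.
rewrite /cofactor expr0 mul1r; congr (\det _); apply/matrixP => i j.
move: (LA i (lift ord0 j)); rewrite !mxE/= => ->.
by rewrite (nth_map (0, 0)).
Qed.

Lemma twisted_wronskian_swap l1 f g l2 :
  Wr (l1 ++ f :: g :: l2) = - Wr (l1 ++ g :: f :: l2).
Proof.
set n := size (l1 ++ f :: g :: l2).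
have sz : size (l1 ++ g :: f :: l2) = n by rewrite /n !size_cat.
rewrite (twisted_wronskianE sz) (twisted_wronskianE (erefl : _ = n)).
have h1 : (size l1 < n)%N by rewrite /n size_cat/=; lia.
have h2 : ((size l1).+1 < n)%N by rewrite /n size_cat/=; lia.
set A := (X in - \det X).
have -> : \det A = \det (A *m tperm_mx (Ordinal h1) (Ordinal h2)) * -1.
  rewrite det_mulmx det_perm odd_tperm -val_eqE/= ltn_eqF//= expr1.
  by rewrite mulrAC -mulrA mulrNN !mulr1.
rewrite mulrN1 opprK -xcolE; congr (\det _); apply/matrixP => i j.
rewrite !mxE; case: tpermP => [->|->|/eqP + /eqP +].
- by rewrite /= !nth_cat ltnn ltnNge leqnSn/= subnn subSnn.
- by rewrite /= !nth_cat ltnn ltnNge leqnSn/= subnn subSnn.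
rewrite -!val_eqE/= => j1 j2; rewrite !nth_cat; case: ltnP => // jl.
by case: (j - size l1)%N (subnKC jl) => [|[|k]] e //=; lia.
Qed.

Lemma twisted_wronskian_move l1 f l2 l3 :
  Wr (l1 ++ f :: l2 ++ l3) = (-1) ^+ size l2 * Wr (l1 ++ l2 ++ f :: l3).
Proof.
elim: l2 l1 => [|g l2 IH] l1; first by rewrite mul1r.
rewrite /= twisted_wronskian_swap -cat_rcons IH exprS mulN1r mulNr.
by rewrite cat_rcons.
Qed.

(** Used in the inductions: a nonzero Wronskian forces its leading seed to be nonzero, so that a
    Darboux step along it is possible. *)
Lemma twisted_wronskian_cons0 f l : f.2 = 0 -> Wr (f :: l) = 0.
Proof.
move=> f0; rewrite /Wr (expand_det_col _ ord0) big1// => i _.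
rewrite !mxE/= f0 (_ : iter i _ 0 = 0) ?mul0r//.
by elim: (nat_of_ord i) => //= k ->; rewrite raddf0.
Qed.

Lemma twisted_wronskian0 : Wr [::] = 1.
Proof. exact: det_mx00. Qed.

Lemma twisted_wronskian1 f : Wr [:: f] = f.2.
Proof. by rewrite /Wr det_mx11 mxE. Qed.

Lemma det_mx22 (A : 'M[K]_2) :
  \det A = A 0 0 * A 1 1 - A 0 1 * A 1 0.
Proof.
rewrite (expand_det_col _ ord0) !big_ord_recl big_ord0 /cofactor !det_mx11 !mxE.
have -> : lift ord0 ord0 = 1 :> 'I_2 by apply/val_inj.
have -> : lift 1 0 = 0 :> 'I_2 by apply/val_inj.
by rewrite /= /bump/= !add0n; ring.
Qed.

Lemma twisted_wronskian2 f g : Wr [:: f; g] = f.2 * td g.1 g.2 - td f.1 f.2 * g.2.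
Proof. by rewrite /Wr det_mx22 !mxE/=; ring. Qed.

Lemma twisted_wronskian3 f g h : Wr [:: f; g; h] =
  f.2 * (td g.1 g.2 * td h.1 (td h.1 h.2) - td g.1 (td g.1 g.2) * td h.1 h.2)
  - td f.1 f.2 * (g.2 * td h.1 (td h.1 h.2) - td g.1 (td g.1 g.2) * h.2)
  + td f.1 (td f.1 f.2) * (g.2 * td h.1 h.2 - td g.1 g.2 * h.2).
Proof.
rewrite /Wr (expand_det_col _ ord0) !big_ord_recl big_ord0 /cofactor.
by rewrite !det_mx22 !mxE/=; ring.
Qed.

(** The clause [d lam = 0] is part of the notion because the Darboux step differentiates the
    equation. *)
Definition eigen (c b v lam : K) (f : K * K) : Prop :=
  c * td f.1 (td f.1 f.2) + b * td f.1 f.2 + v * f.2 + lam * f.2 = 0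
  /\ d lam = 0.

Lemma darboux_eigen c b v lam0 lam f g (a := td f.1 f.2 / f.2) :
  f.2 != 0 -> eigen c b v lam0 f -> eigen c b v lam g ->
  eigen c (b + d c) (v + d b + 2 * c * d a + d c * a) lam (darboux f g).
Proof.
move=> f0 [Ef dl0] [Eg dl]; split=> //; rewrite /darboux/=.
case: f @a f0 Ef => wf f0 /= f0N Ef; case: g Eg => w g /= Eg.
set a := td wf f0 / f0.
(* The Riccati equation of the log-derivative [a] of [f]; [lam0], being constant, disappears from
   its derivative [dric]. *)
have ric : c * (d a + a ^+ 2) + b * a + v + lam0 = 0.
  have da : d a = td wf (td wf f0) / f0 - a ^+ 2.
    have := td_div wf wf (td wf f0) f0N; rewrite subrr tdE mul0r addr0 => ->.
    by rewrite /a; field.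
  apply: (mulIf f0N); rewrite mul0r -Ef da /a.
  by field.
clearbody a.
have dric : d c * (d a + a ^+ 2) + c * (d (d a) + 2 * a * d a)
    + (d b * a + b * d a) + d v = 0.
  by have := congr1 d ric; rewrite raddf0 expr2 !raddfD/= !dM !raddfD/= dM dl0 => <-; ring.
have Eg' : d c * td w (td w g) + c * td w (td w (td w g))
    + (d b * td w g + b * td w (td w g)) + (d v * g + v * td w g) + lam * td w g = 0.
  by have := congr1 (td w) Eg; rewrite raddf0 !raddfD/= !tdZ dl mul0r add0r => <-; ring.
rewrite !raddfB/= !tdZ !raddfD/= !tdZ.
(* The transformed equation is [D - a] applied to the equation of [g], minus [g] times the
   differentiated Riccati equation. *)
transitivity ((d c * td w (td w g) + c * td w (td w (td w g))
    + (d b * td w g + b * td w (td w g)) + (d v * g + v * td w g) + lam * td w g)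
  - a * (c * td w (td w g) + b * td w g + v * g + lam * g)
  - g * (d c * (d a + a ^+ 2) + c * (d (d a) + 2 * a * d a)
    + (d b * a + b * d a) + d v)); first by ring.
by rewrite Eg Eg' dric; ring.
Qed.

(** * Log-derivatives of Wronskians and Crum chains *)

Definition total_twist (l : seq (K * K)) : K := \sum_(f <- l) f.1.

(** [total_twist l] is the log-derivative of the product of the weights that [twisted_wronskian]
    divides out, so this is the log-derivative of the genuine Wronskian. *)
Definition log_deriv (l : seq (K * K)) : K := td (total_twist l) (Wr l) / Wr l.

Lemma total_twist_cat l1 l2 : total_twist (l1 ++ l2) = total_twist l1 + total_twist l2.
Proof. exact: big_cat. Qed.

Lemma total_twist_cons f l : total_twist (f :: l) = f.1 + total_twist l.
Proof. exact: big_cons. Qed.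

Lemma total_twist_darboux f l : total_twist (map (darboux f) l) = total_twist l.
Proof. by rewrite /total_twist big_map. Qed.

Lemma eigenE c b v lam f : c != 0 -> eigen c b v lam f ->
  td f.1 (td f.1 f.2) = - (b * td f.1 f.2 + (v + lam) * f.2) / c.
Proof.
move=> c0 [E _]; apply: (mulfI c0); apply/eqP; rewrite -subr_eq0 -[X in _ == X]E.
by apply/eqP; field.
Qed.

(** Abel's identity for two different eigenvalues: the terms in [v] cancel and the eigenvalue
    difference survives. The second clause is the derivative of the first. *)
Lemma deriv_pair_wronskian c b v lg lh g h
    (w0 := Wr [:: g; h]) (w1 := td (g.1 + h.1) w0) :
  c != 0 -> eigen c b v lg g -> eigen c b v lh h ->
  w1 = (- b * w0 + (lg - lh) * (g.2 * h.2)) / c /\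
  td (g.1 + h.1) w1 = (- d c * w1 - d b * w0 - b * w1
     + (lg - lh) * (td g.1 g.2 * h.2 + g.2 * td h.1 h.2)) / c.
Proof.
move=> c0 Eg Eh.
have e : c * w1 = - b * w0 + (lg - lh) * (g.2 * h.2).
  rewrite /w1 /w0 twisted_wronskian2 raddfB/= !tdM (eigenE c0 Eg) (eigenE c0 Eh).
  by field.
split; first by rewrite -e; field.
have := congr1 (td (g.1 + h.1)) e.
rewrite raddfD/= mulNr raddfN/= (tdZ _ c) (tdZ _ b) (tdZ _ (lg - lh)) tdM.
rewrite raddfB/= Eg.2 Eh.2 subrr mul0r add0r -/w1 => e'.
apply: (mulfI c0); apply: (addrI (d c * w1)); rewrite e'; field.
exact: c0.
Qed.

Lemma td_div0 w1 w2 u1 u2 : u2 != 0 -> forall w, w = w1 - w2 ->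
  td w (u1 / u2) = (td w1 u1 * u2 - u1 * td w2 u2) / u2 ^+ 2.
Proof. by move=> h w ->; apply: td_div. Qed.

Lemma td2_div w1 w2 u1 u2 : u2 != 0 -> forall w, w = w1 - w2 ->
  td w (td w (u1 / u2)) = (td w1 (td w1 u1) * u2 - u1 * td w2 (td w2 u2)) / u2 ^+ 2
   - 2 * td w2 u2 * (td w1 u1 * u2 - u1 * td w2 u2) / u2 ^+ 3.
Proof.
move=> h w ->; rewrite (td_div w1 w2)//.
(* The first derivative is a numerator of twist [w1 + w2] over [u2 ^+ 2], of twist [w2 + w2]; in
   this form the quotient rule applies again. *)
have -> : w1 - w2 = (w1 + w2) - (w2 + w2) by ring.
rewrite (_ : u2 ^+ 2 = u2 * u2)// td_div ?mulf_neq0// raddfB/= !tdM; field.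
exact: h.
Qed.

(** The operator is the Darboux transform along [f]. Once Abel's identity removes the derivatives of
    [W(g, h)] and the equation of [f] removes its second derivative, a rational identity in [f],
    [g], [h] and their first derivatives remains. *)
Lemma replace_base c b v lf lg lh f g h
    (y := Wr [:: g; h] / Wr [:: f]) (w := g.1 + h.1 - f.1) (L := log_deriv [:: f]) :
  c != 0 -> f.2 != 0 -> eigen c b v lf f -> eigen c b v lg g -> eigen c b v lh h ->
  c * td w (td w y) + (b + d c) * td w y + (v + d b + 2 * c * d L + d c * L) * y
    + (lf + lg - lh) * y
  = 2 * (lg - lh) * (Wr [:: f; h] * Wr [:: g]) / Wr [:: f] ^+ 2.
Proof.
move=> c0 f0 Ef Eg Eh; rewrite /w /y /L /log_deriv !twisted_wronskian1.
rewrite (td2_div (w1 := g.1 + h.1) (w2 := f.1))// (td_div0 (w1 := g.1 + h.1) (w2 := f.1))//.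
have -> : total_twist [:: f] = f.1 by rewrite /total_twist big_seq1.
have -> : d (td f.1 f.2 / f.2) = td f.1 (td f.1 f.2) / f.2 - (td f.1 f.2 / f.2) ^+ 2.
  have := td_div f.1 f.1 (td f.1 f.2) f0; rewrite subrr tdE mul0r addr0 => ->.
  by field.
have [] := deriv_pair_wronskian c0 Eg Eh.
set w1 := td _ _ => e1 ->; rewrite {}e1 (eigenE c0 Ef).
by rewrite !twisted_wronskian2; field; apply/andP.
Qed.

Lemma td_shift w e u : td (w - e) u = td w u - e * u.
Proof. by rewrite !tdE; ring. Qed.

(* Removing two seeds lands in the gauge of the inverse square of the weight
   of [c D^2 + b D], whence the extra twist [- (b + d c) / c]. *)
Lemma remove_base c b v l1 l2 lh f1 f2 h (W := Wr [:: f1; f2])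
    (y := Wr [:: h] / W) (w := h.1 - f1.1 - f2.1 - (b + d c) / c)
    (L := log_deriv [:: f1; f2]) :
  c != 0 -> W != 0 -> eigen c b v l1 f1 -> eigen c b v l2 f2 -> eigen c b v lh h ->
  c * td w (td w y) + (b + 2 * d c) * td w y
    + (v + 2 * d b + d (d c) + 2 * c * d L + d c * L) * y
    + (l1 + l2 - lh) * y
  = 2 * c * Wr [:: f1; f2; h] / W ^+ 2.
Proof.
move=> c0 W0 E1 E2 Eh; rewrite /w /y /L /log_deriv !twisted_wronskian1.
have ew : h.1 - f1.1 - f2.1 = h.1 - (f1.1 + f2.1) by ring.
have -> : total_twist [:: f1; f2] = f1.1 + f2.1 by rewrite /total_twist big_cons big_seq1.
rewrite !(td_shift _ ((b + d c) / c)) raddfB/= (tdZ _ ((b + d c) / c)).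
rewrite (td2_div h.2 W0 ew) (td_div0 h.2 W0 ew) -/W.
have -> : d ((b + d c) / c) = (d b + d (d c)) / c - (b + d c) * d c / c ^+ 2.
  by rewrite dM raddfD derivV//=; field.
have -> : d (td (f1.1 + f2.1) W / W) =
   td (f1.1 + f2.1) (td (f1.1 + f2.1) W) / W - (td (f1.1 + f2.1) W / W) ^+ 2.
  have := td_div (f1.1 + f2.1) (f1.1 + f2.1) (td (f1.1 + f2.1) W) W0.
  rewrite subrr tdE mul0r addr0 => ->.
  by field.
have [] := deriv_pair_wronskian c0 E1 E2; rewrite -/W.
set W1 := td _ _ => e1 ->; rewrite {}e1.
rewrite twisted_wronskian3 (eigenE c0 E1) (eigenE c0 E2) (eigenE c0 Eh).
have eW : W = _ := twisted_wronskian2 f1 f2; rewrite eW in W0 *.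
by field; apply/andP.
Qed.
(** The zeroth order coefficient after [r] Darboux steps, [L] being the log-derivative of the
    Wronskian of the seeds used. The first order coefficient grows by [d c] at each step, so the
    successive contributions [d b + k * d (d c)] sum to the binomial term. *)
Definition crum_potential (c b v : K) (r : nat) (L : K) : K :=
  v + r%:R * d b + 'C(r, 2)%:R * d (d c) + 2 * c * d L + d c * L.

(** The invariant behind the inductions: one Darboux step along a seed of log-derivative [a]
    followed by [r] steps gives the same potential as [r + 1] steps at once. *)
Lemma crum_potentialS c b v r a L :
  crum_potential c b v r.+1 (a + L) =
  crum_potential c (b + d c) (v + d b + 2 * c * d a + d c * a) r L.
Proof.
by rewrite /crum_potential (binS r 1) bin1 -[r.+1%:R]natr1 natrD !(raddfD d)/=; ring.
Qed.

Lemma log_deriv_cons f l : f.2 != 0 -> Wr (map (darboux f) l) != 0 ->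
  log_deriv (f :: l) = td f.1 f.2 / f.2 + log_deriv (map (darboux f) l).
Proof.
move=> f0 W0; rewrite /log_deriv twisted_wronskian_cons// total_twist_cons tdM.
by rewrite total_twist_darboux; field; apply/andP.
Qed.

Lemma eigen_darboux_seq c b v f lam l (a := td f.1 f.2 / f.2) :
  f.2 != 0 -> eigen c b v lam f ->
  (forall g, g \in l -> exists lam, eigen c b v lam g) ->
  forall g, g \in map (darboux f) l ->
    exists lam, eigen c (b + d c) (v + d b + 2 * c * d a + d c * a) lam g.
Proof.
move=> f0 Ef El _ /mapP[g gl ->]; have [mu Eg] := El g gl.
by exists mu; apply: (darboux_eigen f0 Ef Eg).
Qed.

(** Induction on the unchanged seeds [F]. Peeling off the first one, [k], multiplies every Wronskian
    by [k.2]; both sides are homogeneous of degree 0 in these, and [crum_potentialS] passes [k] into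
    the operator. *)
Lemma crum_replace c b v lf lg lh F f g h (r := (size F).+1) (W := Wr (F ++ [:: f]))
    (y := Wr (F ++ [:: g; h]) / W) (w := g.1 + h.1 - f.1) :
  c != 0 -> W != 0 -> (forall k, k \in F -> exists lam, eigen c b v lam k) ->
  eigen c b v lf f -> eigen c b v lg g -> eigen c b v lh h ->
  c * td w (td w y) + (b + r%:R * d c) * td w y
    + crum_potential c b v r (log_deriv (F ++ [:: f])) * y + (lf + lg - lh) * y
  = 2 * (lg - lh) * (Wr (F ++ [:: f; h]) * Wr (F ++ [:: g])) / W ^+ 2.
Proof.
move=> c0; rewrite /w /y /W /r {w y W r}; move sF: (size F) => n.
elim: n F sF b v f g h => [|n IH] [|k F]//= sF b v f g h.
  move=> W0 _ Ef Eg Eh; have f0 : f.2 != 0 by rewrite -twisted_wronskian1.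
  have := replace_base c0 f0 Ef Eg Eh.
  by rewrite /crum_potential bin_small// mul0r addr0 !mul1r => ->.
case: sF => sF.
have [k0|k0] := eqVneq k.2 0; first by rewrite twisted_wronskian_cons0 ?eqxx.
rewrite !twisted_wronskian_cons// mulf_eq0 negb_or k0/= => W0 EF Ef Eg Eh.
rewrite log_deriv_cons// crum_potentialS.
have [lk Ek] := EF k (mem_head _ _).
have EF' g' : g' \in F -> exists lam, eigen c b v lam g'.
  by move=> gF; apply: EF; rewrite inE gF orbT.
rewrite !map_cat/= in W0 *.
have -> : b + n.+2%:R * d c = (b + d c) + n.+1%:R * d c by rewrite -[n.+2%:R]natr1; ring.
rewrite -!mulf_div divff// mul1r.
have := IH (map (darboux k) F) _ _ _ (darboux k f) (darboux k g) (darboux k h).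
rewrite size_map sF => /(_ erefl _ _ W0 (eigen_darboux_seq k0 Ek EF')
  (darboux_eigen k0 Ek Ef) (darboux_eigen k0 Ek Eg) (darboux_eigen k0 Ek Eh)) -> .
by field; apply/andP.
Qed.

Lemma crum_remove c b v l1 l2 lh F f1 f2 h (r := (size F).+2)
    (W := Wr (F ++ [:: f1; f2])) (y := Wr (F ++ [:: h]) / W)
    (w := h.1 - f1.1 - f2.1 - (b + (size F).+1%:R * d c) / c) :
  c != 0 -> W != 0 -> (forall k, k \in F -> exists lam, eigen c b v lam k) ->
  eigen c b v l1 f1 -> eigen c b v l2 f2 -> eigen c b v lh h ->
  c * td w (td w y) + (b + r%:R * d c) * td w y
    + crum_potential c b v r (log_deriv (F ++ [:: f1; f2])) * y + (l1 + l2 - lh) * y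
  = 2 * c * (Wr (F ++ [:: f1; f2; h]) * Wr F) / W ^+ 2.
Proof.
move=> c0; rewrite /w /y /W /r {w y W r}; move sF: (size F) => n.
elim: n F sF b v f1 f2 h => [|n IH] [|k F]//= sF b v f1 f2 h.
  move=> W0 _ E1 E2 Eh.
  have := remove_base c0 W0 E1 E2 Eh.
  by rewrite /crum_potential binn !mul1r twisted_wronskian0 mulr1 => ->.
case: sF => sF.
have [k0|k0] := eqVneq k.2 0; first by rewrite twisted_wronskian_cons0 ?eqxx.
rewrite !twisted_wronskian_cons// mulf_eq0 negb_or k0/= => W0 EF E1 E2 Eh.
rewrite log_deriv_cons// crum_potentialS.
have [lk Ek] := EF k (mem_head _ _).
have EF' g' : g' \in F -> exists lam, eigen c b v lam g'.
  by move=> gF; apply: EF; rewrite inE gF orbT.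
rewrite !map_cat/= in W0 *.
have -> : b + n.+3%:R * d c = (b + d c) + n.+2%:R * d c by rewrite -[n.+3%:R]natr1; ring.
(* This rewriting is for the extra twist in [w]: it is computed from the first order coefficient one
   step short of [r], and stays the same when [k] is absorbed. *)
have -> : b + n.+2%:R * d c = (b + d c) + n.+1%:R * d c by rewrite -[n.+2%:R]natr1; ring.
rewrite -!mulf_div divff// mul1r.
have := IH (map (darboux k) F) _ _ _ (darboux k f1) (darboux k f2) (darboux k h).
rewrite size_map sF => /(_ erefl _ _ W0 (eigen_darboux_seq k0 Ek EF')
  (darboux_eigen k0 Ek E1) (darboux_eigen k0 Ek E2) (darboux_eigen k0 Ek Eh)) -> .
by field; apply/andP.
Qed.
Lemma log_deriv_sign e l1 l2 : total_twist l1 = total_twist l2 ->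
  Wr l1 = (-1) ^+ e * Wr l2 -> log_deriv l1 = log_deriv l2.
Proof.
move=> et eW; rewrite /log_deriv et eW; case: (boolP (odd e)) => oe.
  by rewrite -signr_odd oe expr1 !mulN1r raddfN/= invrN mulrNN.
by rewrite -signr_odd (negbTE oe) expr0 !mul1r.
Qed.

(** The new seed takes the position of the old one, so all four Wronskians acquire the same sign
    [(-1) ^+ size l2] when it is moved to the end, and the signs cancel. *)
Lemma crum_replace_at c b v lf lg lh l1 l2 f g h (r := (size (l1 ++ l2)).+1)
    (W := Wr (l1 ++ f :: l2)) (y := Wr (l1 ++ g :: l2 ++ [:: h]) / W)
    (w := g.1 + h.1 - f.1) :
  c != 0 -> W != 0 -> (forall k, k \in l1 ++ l2 -> exists lam, eigen c b v lam k) ->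
  eigen c b v lf f -> eigen c b v lg g -> eigen c b v lh h ->
  c * td w (td w y) + (b + r%:R * d c) * td w y
    + crum_potential c b v r (log_deriv (l1 ++ f :: l2)) * y + (lf + lg - lh) * y
  = 2 * (lg - lh) * (Wr (l1 ++ f :: l2 ++ [:: h]) * Wr (l1 ++ g :: l2)) / W ^+ 2.
Proof.
move=> c0; rewrite /w /y /W => {w y W} W0 EF Ef Eg Eh.
have mv k : Wr (l1 ++ k :: l2) = (-1) ^+ size l2 * Wr ((l1 ++ l2) ++ [:: k]).
  by rewrite -{1}[l2]cats0 twisted_wronskian_move catA.
have mv2 k : Wr (l1 ++ k :: l2 ++ [:: h]) =
    (-1) ^+ size l2 * Wr ((l1 ++ l2) ++ [:: k; h]).
  by rewrite twisted_wronskian_move catA.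
have s0 : (-1) ^+ size l2 != 0 :> K by rewrite expf_neq0// oppr_eq0 oner_eq0.
have W0' : Wr ((l1 ++ l2) ++ [:: f]) != 0.
  by apply: contra_neq W0 => W0; rewrite mv W0 mulr0.
have := crum_replace c0 W0' EF Ef Eg Eh.
rewrite (log_deriv_sign _ (mv f)); last first.
  by rewrite !total_twist_cat !total_twist_cons /total_twist big_nil; ring.
rewrite !mv2 !mv -!mulf_div divff// mul1r => ->.
by field; apply/andP.
Qed.

(** Moving [f2] past [l3], then [f1] past [l2 ++ l3], costs the sign [(-1) ^+ e]. It affects the
    Wronskians of [D] and [D ++ [:: h]] but not those without [f1] and [f2], hence occurs once on
    each side. *)
Lemma crum_remove_at c b v lam1 lam2 lh l1 l2 l3 f1 f2 h
    (D := l1 ++ f1 :: l2 ++ f2 :: l3) (F := l1 ++ l2 ++ l3) (r := (size F).+2)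
    (y := Wr (F ++ [:: h]) / Wr D)
    (w := h.1 - f1.1 - f2.1 - (b + (size F).+1%:R * d c) / c) :
  c != 0 -> Wr D != 0 -> (forall k, k \in F -> exists lam, eigen c b v lam k) ->
  eigen c b v lam1 f1 -> eigen c b v lam2 f2 -> eigen c b v lh h ->
  c * td w (td w y) + (b + r%:R * d c) * td w y
    + crum_potential c b v r (log_deriv D) * y + (lam1 + lam2 - lh) * y
  = 2 * c * (Wr (D ++ [:: h]) * Wr F) / Wr D ^+ 2.
Proof.
move=> c0 W0 EF E1 E2 Eh.
pose e := (size l3 + size (l2 ++ l3))%N.
have mv l : Wr (l1 ++ f1 :: l2 ++ f2 :: l3 ++ l) = (-1) ^+ e * Wr (F ++ [:: f1, f2 & l]).
  have := twisted_wronskian_move (l1 ++ f1 :: l2) f2 l3 l.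
  rewrite -!catA/= => ->; have := twisted_wronskian_move l1 f1 (l2 ++ l3) (f2 :: l).
  by rewrite -!catA/= => ->; rewrite mulrA -exprD /F -?catA.
have mvD : Wr D = (-1) ^+ e * Wr (F ++ [:: f1; f2]) by rewrite -mv cats0.
have mvh : Wr (D ++ [:: h]) = (-1) ^+ e * Wr (F ++ [:: f1; f2; h]).
  by rewrite -mv /D -catA /= -catA.
have s0 : (-1) ^+ e != 0 :> K by rewrite expf_neq0// oppr_eq0 oner_eq0.
have W0' : Wr (F ++ [:: f1; f2]) != 0.
  by apply: contra_neq W0 => W0; rewrite mvD W0 mulr0.
have := crum_remove c0 W0' EF E1 E2 Eh.
rewrite (log_deriv_sign _ mvD); last first.
  by rewrite !(total_twist_cat, total_twist_cons) /total_twist big_nil; ring.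
have ey : y = (-1) ^+ e * (Wr (F ++ [:: h]) / Wr (F ++ [:: f1; f2])).
  rewrite /y mvD invfM mulrCA; congr (_ * _).
  by rewrite -exprVn invrN1.
rewrite mvD mvh -/r -/w ey => H; clear ey.
have tds x : td w ((-1) ^+ e * x) = (-1) ^+ e * td w x.
  by rewrite -signr_odd; case: odd; rewrite ?expr1 ?expr0 ?mulN1r ?raddfN/= ?mul1r.
rewrite !tds; transitivity ((-1) ^+ e * (2 * c * (Wr (F ++ [:: f1; f2; h]) * Wr F) /
   Wr (F ++ [:: f1; f2]) ^+ 2)); first by rewrite -H; ring.
have -> : ((-1) ^+ e * Wr (F ++ [:: f1; f2])) ^+ 2 = Wr (F ++ [:: f1; f2]) ^+ 2.
  by rewrite exprMn -exprM mulnC exprM sqrrN expr1n expr1n mul1r.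
by field.
Qed.
End TwistedWronskian.

(** * The derivation of the field of rational functions *)

Local Notation "p %:F" := (FracField.tofrac p).

Section QuotientRules.
Variable F : fieldType.
Implicit Types p q n d : F.

(** Independence of the quotient rule from the representation of a fraction. The primed letters
    stand for derivatives, and the second equation is the derivative of [p * d = n * q]. *)
Lemma quotient_rule_indep n n' d d' p p' q q' : d != 0 -> q != 0 ->
  p * d = n * q -> p' * d + p * d' = n' * q + n * q' ->
  (n' - p / q * d') / d = (p' * q - p * q') / q ^+ 2.
Proof.
move=> d0 q0 e0 e1; apply: (mulIf (mulf_neq0 d0 (expf_neq0 2 q0))).
transitivity (n' * q * q - p * d' * q); first by field; apply/andP.
have -> : n' * q = p' * d + p * d' - n * q' by rewrite e1; ring.
transitivity (p' * d * q - (n * q) * q'); first by ring.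
by rewrite -e0; field.
Qed.

Lemma cross_multiply n d p q x : d != 0 -> q != 0 -> x = n / d -> p / q = x -> p * d = n * q.
Proof. by move=> d0 q0 -> /eqP; rewrite eqr_div// => /eqP. Qed.

Lemma quotient_ruleB p p' q q' r r' t t' : q != 0 -> t != 0 ->
  ((p' * t + p * t' - (r' * q + r * q')) * (q * t) - (p * t - r * q) * (q' * t + q * t'))
    / (q * t) ^+ 2
  = (p' * q - p * q') / q ^+ 2 - (r' * t - r * t') / t ^+ 2 :> F.
Proof. by move=> q0 t0; field; apply/andP. Qed.

Lemma quotient_ruleM p p' q q' r r' t t' : q != 0 -> t != 0 ->
  ((p' * r + p * r') * (q * t) - (p * r) * (q' * t + q * t')) / (q * t) ^+ 2
  = (p' * q - p * q') / q ^+ 2 * (r / t) + p / q * ((r' * t - r * t') / t ^+ 2) :> F.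
Proof. by move=> q0 t0; field; apply/andP. Qed.

Lemma divB_common p q r t : q != 0 -> t != 0 ->
  p / q - r / t = (p * t - r * q) / (q * t).
Proof. by move=> q0 t0; field; apply/andP. Qed.
End QuotientRules.

Section FractionDerivative.
Variable R : idomainType.
Local Notation K := {fraction {poly R}}.

Lemma frac_repr (x : K) :
  x = (frac (repr x)).1%:F / (frac (repr x)).2%:F.
Proof.
rewrite -[LHS]reprK; set r := repr x; rewrite -{1}(Ratio_numden r).
have dn0 := denom_ratioP r.
unlock FracField.tofrac; rewrite -[X in _ = _ * X]FracField.pi_inv -[RHS]FracField.pi_mul.
rewrite /FracField.mulf /FracField.invf.
by rewrite !numden_Ratio ?oner_eq0 ?mulr1 ?mul1r.
Qed.

(** The quotient rule [(n' - x * d') / d] for a chosen representative [x = n / d]; [frac_deriv_div]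
    shows that any other one gives the same value. *)
Definition frac_deriv (x : K) : K :=
  (((frac (repr x)).1)^`()%:F - x * ((frac (repr x)).2)^`()%:F) / (frac (repr x)).2%:F.

Lemma frac_deriv_div (p q : {poly R}) : q != 0 ->
  frac_deriv (p%:F / q%:F) = (p^`()%:F * q%:F - p%:F * q^`()%:F) / q%:F ^+ 2.
Proof.
move=> q0; move: {2}(p%:F / q%:F) (erefl (p%:F / q%:F)) => x xE.
rewrite /frac_deriv xE.
have dn0 : (frac (repr x)).2%:F != 0 :> K by rewrite tofrac_eq0 denom_ratioP.
have q0F : q%:F != 0 :> K by rewrite tofrac_eq0.
move: (frac_repr x) dn0; set n := (frac (repr x)).1; set d := (frac (repr x)).2 => ex d0.
have E0 := cross_multiply d0 q0F ex xE.
have E : p * d = n * q by apply/eqP; rewrite -tofrac_eq !rmorphM/=; apply/eqP.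
have E1 : p^`()%:F * d%:F + p%:F * d^`()%:F = n^`()%:F * q%:F + n%:F * q^`()%:F :> K.
  by rewrite -!rmorphM -!rmorphD -!derivM E.
rewrite -xE; exact: (quotient_rule_indep d0 q0F E0 E1).
Qed.

Lemma frac_deriv_tofrac p : frac_deriv p%:F = p^`()%:F.
Proof.
have := frac_deriv_div p (oner_neq0 _).
by rewrite rmorph1 divr1 expr1n divr1 derivC mulr1 rmorph0 mulr0 subr0.
Qed.

Lemma frac_ind (x : K) : exists p q, q%:F != 0 :> K /\ x = p%:F / q%:F.
Proof.
exists (frac (repr x)).1, (frac (repr x)).2; split; last exact: frac_repr.
by rewrite tofrac_eq0 denom_ratioP.
Qed.

Lemma frac_deriv_is_additive : zmod_morphism frac_deriv.
Proof.
move=> x y; have [p [q [q0 ->]]] := frac_ind x; have [r [t [t0 ->]]] := frac_ind y.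
have -> : p%:F / q%:F - r%:F / t%:F = (p * t - r * q)%:F / (q * t)%:F :> K.
  by rewrite (divB_common _ _ q0 t0) !tofracM tofracB !tofracM.
move: (q0) (t0); rewrite !tofrac_eq0 => q0' t0'.
rewrite !frac_deriv_div ?mulf_neq0// derivB !derivM !(tofracM, tofracB, tofracD).
exact: (quotient_ruleB _ _ _ _ _ _ q0 t0).
Qed.

HB.instance Definition _ :=
  GRing.isZmodMorphism.Build K K frac_deriv frac_deriv_is_additive.

Lemma frac_derivM (x y : K) :
  frac_deriv (x * y) = frac_deriv x * y + x * frac_deriv y.
Proof.
have [p [q [q0 ->]]] := frac_ind x; have [r [t [t0 ->]]] := frac_ind y.
have -> : p%:F / q%:F * (r%:F / t%:F) = (p * r)%:F / (q * t)%:F :> K.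
  by rewrite mulf_div !tofracM.
move: (q0) (t0); rewrite !tofrac_eq0 => q0' t0'.
rewrite !frac_deriv_div ?mulf_neq0// !derivM !(tofracM, tofracD).
exact: (quotient_ruleM _ _ _ _ _ _ q0 t0).
Qed.
End FractionDerivative.

(** * Determinants of polynomial jets *)

(** Among [n + 1] distinct naturals one is at least [n], by pigeonhole; remove it and induct. *)
Lemma leq_sum_uniq (s : seq nat) : uniq s -> ('C(size s, 2) <= sumn s)%N.
Proof.
move e: (size s) => n; elim: n s e => // n IH s e us.
have [m ms nm] : exists2 m, m \in s & (n <= m)%N.
  apply/hasP; apply: contraT; rewrite -all_predC => /allP sn.
  suff : (size s <= size (iota 0 n))%N by rewrite e size_iota ltnn.
  apply: uniq_leq_size => // m /sn; rewrite /= -ltnNge mem_iota add0n => ->.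
  by rewrite leq0n.
rewrite (perm_sumn (perm_to_rem ms))/= binS bin1 addnC leq_add//.
by rewrite IH ?rem_uniq// size_rem ?e.
Qed.

Lemma leq_sum_inj (I : finType) (P : pred I) (f : I -> nat) :
  (forall i j, P i -> P j -> f i = f j -> i = j) ->
  ('C(#|P|, 2) <= \sum_(i | P i) f i)%N.
Proof.
move=> fP; have -> : (\sum_(i | P i) f i = sumn (map f (enum P)))%N.
  by rewrite sumnE big_map big_enum.
rewrite cardE -(size_map f); apply: leq_sum_uniq.
rewrite map_inj_in_uniq ?enum_uniq// => i j.
by rewrite !mem_enum; apply: fP.
Qed.

Section DegreeBound.
Variable R : comNzRingType.
Implicit Types p q : {poly R}.

(* Integer-valued bounds, so that a negative bound forces the polynomial to vanish. *)
Definition deg_le p (z : int) : Prop := forall i : nat, z < i%:Z -> p`_i = 0.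

Lemma deg_le0 z : deg_le 0 z. Proof. by move=> i _; rewrite coef0. Qed.

Lemma deg_le_trans p y z : y <= z -> deg_le p y -> deg_le p z.
Proof. by move=> yz py i zi; apply: py; apply: le_lt_trans zi. Qed.

Lemma deg_leD p q z : deg_le p z -> deg_le q z -> deg_le (p + q) z.
Proof. by move=> pz qz i zi; rewrite coefD pz// qz// addr0. Qed.

Lemma deg_leZ a p z : deg_le p z -> deg_le (a *: p) z.
Proof. by move=> pz i zi; rewrite coefZ pz// mulr0. Qed.

Lemma deg_leM p q y z : deg_le p y -> deg_le q z -> deg_le (p * q) (y + z).
Proof.
move=> py qz i yzi; rewrite coefM big1// => j _.
have [yj|jy] := ltP y j%:Z; first by rewrite py// mul0r.
by rewrite qz ?mulr0//; have := ltn_ord j; lia.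
Qed.

Lemma deg_leXn p n y : deg_le p y -> deg_le (p ^+ n) (y * n%:Z).
Proof.
move=> py; elim: n => [|n IH].
  by rewrite expr0 mulr0 => -[|i]//; rewrite coef1.
by rewrite exprS; apply: deg_le_trans (deg_leM py IH); lia.
Qed.

Lemma deg_le_prod (I : finType) (F : I -> {poly R}) (z : I -> int) :
  (forall i, deg_le (F i) (z i)) -> deg_le (\prod_i F i) (\sum_i z i).
Proof.
move=> Fz; elim/big_ind2: _ => [|p y q y'|i _]; last exact: Fz.
  by move=> [|i]//; rewrite coef1.
exact: deg_leM.
Qed.

Lemma deg_le_derivn p z k : deg_le p z -> deg_le p^`(k) (z - k%:Z).
Proof. by move=> pz i zi; rewrite coef_derivn pz ?mul0rn//; lia. Qed.

Lemma deg_le_size p n : (size p <= n.+1)%N -> deg_le p n%:Z.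
Proof. by move=> pn i; rewrite ltz_nat => ni; apply/nth_default/(leq_trans pn). Qed.

Lemma size_deg_le p n z : deg_le p z -> z < n%:Z -> (size p <= n)%N.
Proof. by move=> pz zn; apply/leq_sizeP => i ni; apply: pz; lia. Qed.
End DegreeBound.

Lemma det_col_scale (R : comPzRingType) n (M : 'M[R]_n) (y : 'I_n -> R) :
  \det (\matrix_(i, j) (M i j * y j)) = \det M * \prod_j y j.
Proof.
transitivity (\det (M *m diag_mx (\row_j y j))).
  by congr (\det _); apply/matrixP => i j; rewrite mul_mx_diag !mxE.
by rewrite det_mulmx det_diag; congr (_ * _); apply: eq_bigr => j _; rewrite mxE.
Qed.

Lemma det_row_scale (R : comPzRingType) n (M : 'M[R]_n) (y : 'I_n -> R) :
  \det (\matrix_(i, j) (y i * M i j)) = (\prod_j y j) * \det M.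
Proof.
rewrite -det_tr -[\det M]det_tr mulrC -det_col_scale; congr (\det _).
by apply/matrixP => i j; rewrite !mxE mulrC.
Qed.

Lemma det_col_expand (R : comPzRingType) n (M : 'M[R]_n) :
  \det M = \sum_(s : 'S_n) (-1) ^+ s * \prod_j M (s j) j.
Proof.
by rewrite -det_tr /determinant; apply: eq_bigr => s _; congr (_ * _);
   apply: eq_bigr => j _; rewrite mxE.
Qed.

Lemma det_col_multilinear (R : comPzRingType) n (X : 'I_n -> 'I_n -> 'I_n -> R) :
  \det (\matrix_(i, j) \sum_k X i j k)
  = \sum_(f : {ffun 'I_n -> 'I_n}) \det (\matrix_(i, j) X i j (f j)).
Proof.
rewrite det_col_expand; under [RHS]eq_bigr do rewrite det_col_expand.
rewrite exchange_big/=; apply: eq_bigr => s _; rewrite -mulr_sumr; congr (_ * _).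
under eq_bigr do rewrite mxE.
rewrite bigA_distr_bigA/=; apply: eq_bigr => f _.
by apply: eq_bigr => j _; rewrite mxE.
Qed.

(** * Jets of twisted columns and the common factor of their determinant *)

Section Jets.
Variable R : fieldType.
Implicit Types a b c w u : {poly R}.

(* [jet c w u i / c ^+ i] is the [i]-th derivative of [u] twisted by [w / c]. *)
Fixpoint jet c w u (i : nat) : {poly R} :=
  match i with
  | 0 => u
  | i'.+1 => c * (jet c w u i')^`() + (w - c^`() *+ i') * jet c w u i'
  end.

(** For a weight with [theta' / theta = kappa / a] and [a' = s], this is the coefficient of
    [a ^+ k * u^](k)[in]a ^+ i * theta^-1 * (theta * u)^[(i)]. *)
Fixpoint jet_coef (kappa s : R) (i k : nat) : R :=
  match i with
  | 0 => (k == 0)%:R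
  | i'.+1 => (kappa + s * (k%:R - i'%:R)) * jet_coef kappa s i' k
             + (if k is k'.+1 then jet_coef kappa s i' k' else 0)
  end.

Lemma jet_coef_gt kappa s i k : (i < k)%N -> jet_coef kappa s i k = 0.
Proof.
elim: i k => [|i IH] [|k]//= ik.
by rewrite !IH ?mulr0 ?addr0//; lia.
Qed.

Lemma jet_twisted a b s kappa u i N : a^`() = s%:P -> (i < N)%N ->
  jet (a * b) (kappa *: b) u i
  = b ^+ i * \sum_(k < N) jet_coef kappa s i k *: (a ^+ k * u^`(k)).
Proof.
move=> da; elim: i N => [|i IH] N.
  case: N => // N _; rewrite big_ord_recl big1/= ?expr0 ?mul1r ?scale1r ?addr0//.
  by move=> k _; rewrite /= scale0r.
move=> iN; rewrite /= (IH N) ?(ltnW iN)//; set Q := \sum_(k < N) _.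
have aQ' : a * Q^`() = \sum_(k < N) (jet_coef kappa s i k * (s * k%:R)) *: (a ^+ k * u^`(k))
    + \sum_(k < N) jet_coef kappa s i k *: (a ^+ k.+1 * u^`(k.+1)).
  rewrite /Q raddf_sum mulr_sumr -big_split/=; apply: eq_bigr => k _.
  rewrite derivZ derivM deriv_exp da -!mul_polyC -derivnS.
  rewrite !polyCM polyC_natr -mulr_natr.
  by case: (nat_of_ord k) => [|k']; rewrite ?exprS/=; ring.
have step : \sum_(k < N) jet_coef kappa s i.+1 k *: (a ^+ k * u^`(k)) =
    a * Q^`() + (kappa%:P - s%:P *+ i) * Q.
  rewrite aQ' /Q mulr_sumr addrAC -big_split/=.
  rewrite [X in _ = _ + X](_ : _ = \sum_(k < N)
      (if nat_of_ord k is k'.+1 then jet_coef kappa s i k' else 0) *: (a ^+ k * u^`(k))).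
    rewrite -big_split/=; apply: eq_bigr => k _; rewrite -!mul_polyC.
    by rewrite !(polyCD, polyCM, polyCB, polyC_natr) -mulr_natr; ring.
  case: N iN {IH Q aQ'} => // N iN; rewrite big_ord_recr big_ord_recl/= scale0r add0r.
  by rewrite jet_coef_gt ?scale0r ?addr0//; lia.
rewrite step derivM deriv_exp derivM da -!mul_polyC.
case: i {IH Q aQ' iN step} (Q) => [|i] Q'; first by rewrite !expr0 !mulr0n; ring.
by rewrite /= !exprS; ring.
Qed.

Lemma jet_untwisted c u i : jet c 0 u i = c ^+ i * u^`(i).
Proof.
elim: i => [|i IH]; first by rewrite expr0 mul1r.
rewrite /= IH derivM deriv_exp -derivnS sub0r.
case: i {IH} => [|i]; first by rewrite expr0 !mulr0n; ring.
by rewrite /= !exprS; ring.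
Qed.

Variant column_kind := TypeI | TypeII | Untwisted.

Definition eqkind (s t : column_kind) : bool :=
  match s, t with
  | TypeI, TypeI | TypeII, TypeII | Untwisted, Untwisted => true
  | _, _ => false
  end.

Lemma eqkindP : Equality.axiom eqkind.
Proof. by case=> [] []; constructor. Qed.

HB.instance Definition _ := hasDecEq.Build column_kind eqkindP.

Variables (a b : {poly R}) (sa sb kappa1 kappa2 : R).
Hypotheses (da : a^`() = sa%:P) (db : b^`() = sb%:P).

Definition kind_twist (t : column_kind) : {poly R} :=
  match t with
  | TypeI => kappa1 *: b
  | TypeII => kappa2 *: a
  | Untwisted => 0
  end.

Definition kind_coef t (i k : nat) : R :=
  match t with
  | TypeI => jet_coef kappa1 sa i k
  | TypeII => jet_coef kappa2 sb i k
  | Untwisted => (i == k)%:R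
  end.

(** In [jet_kind] the power of [kind_row] is the row index, while the power of [kind_col] is the
    number of derivatives falling on the polynomial. A type I weight is singular only along [a], a
    type II weight only along [b]. *)
Definition kind_row t : {poly R} :=
  match t with TypeI => b | TypeII => a | Untwisted => a * b end.

Definition kind_col t : {poly R} :=
  match t with TypeI => a | TypeII => b | Untwisted => 1 end.

Lemma jet_kind t u i N : (i < N)%N ->
  jet (a * b) (kind_twist t) u i
  = \sum_(k < N) kind_coef t i k *: kind_row t ^+ i * (kind_col t ^+ k * u^`(k)).
Proof.
move=> iN; case: t => /=.
- rewrite (jet_twisted b kappa1 u da iN) mulr_sumr.
  by apply: eq_bigr => k _; rewrite -scalerAr -scalerAl.
- rewrite mulrC (jet_twisted a kappa2 u db iN) mulr_sumr.
  by apply: eq_bigr => k _; rewrite -scalerAr -scalerAl.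
- rewrite jet_untwisted (bigD1 (Ordinal iN))//= eqxx scale1r expr1n mul1r big1 ?addr0//.
  by move=> k; rewrite -val_eqE/= eq_sym => /negPf ->; rewrite scale0r mul0r.
Qed.
Lemma sum_perm_ord n (s : 'S_n) : (\sum_(j < n) s j = 'C(n, 2))%N.
Proof.
rewrite -bin2_sum big_mkord [RHS](reindex_inj (@perm_inj _ s)).
exact: eq_bigr.
Qed.

Lemma leq_sum_perm n (s : 'S_n) (P : pred 'I_n) :
  ('C(#|P|, 2) <= \sum_(j | P j) s j)%N.
Proof. by apply: leq_sum_inj => i j _ _ /val_inj /perm_inj. Qed.

(** In the full expansion, [f j] counts the derivatives of the polynomial of column [j] and [s j] is
    its row. Column [j] contributes [a] to the power [f j] if of type I and [s j] otherwise, and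
    symmetrically for [b]. In a nonzero term [f] is injective on each kind and [s] is a permutation,
    so each exponent sum is at least a sum of two binomials, by [leq_sum_inj]. *)
Lemma jet_det_factor n (t : 'I_n -> column_kind) (u : 'I_n -> {poly R})
    (deg : 'I_n -> nat) (e1 := ('C(#|[pred j | t j == TypeI]|, 2) +
       'C(#|[pred j | t j != TypeI]|, 2))%N)
    (e2 := ('C(#|[pred j | t j != TypeII]|, 2) + 'C(#|[pred j | t j == TypeII]|, 2))%N) :
  deg_le a 1 -> deg_le b 1 -> (forall j, (size (u j) <= (deg j).+1)%N) ->
  exists Q, \det (\matrix_(i, j) jet (a * b) (kind_twist (t j)) (u j) i)
       = a ^+ e1 * b ^+ e2 * Q
    /\ deg_le Q ((\sum_j deg j + 'C(n, 2))%N%:Z - e1%:Z - e2%:Z).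
Proof.
move=> a1 b1 ud.
pose good (p : {poly R}) := exists Q, p = a ^+ e1 * b ^+ e2 * Q
    /\ deg_le Q ((\sum_j deg j + 'C(n, 2))%N%:Z - e1%:Z - e2%:Z).
have good0 : good 0 by exists 0; rewrite mulr0; split=> //; apply: deg_le0.
have goodD p q : good p -> good q -> good (p + q).
  move=> [P [-> dP]] [Q [-> dQ]]; exists (P + Q); rewrite mulrDr; split=> //.
  exact: deg_leD.
rewrite -/(good _).
have -> : \matrix_(i, j) jet (a * b) (kind_twist (t j)) (u j) i
  = \matrix_(i, j) \sum_(k < n) (kind_coef (t j) i k *: kind_row (t j) ^+ i)
       * (kind_col (t j) ^+ k * (u j)^`(k)) :> 'M[{poly R}]_n.
  by apply/matrixP => i j; rewrite !mxE; apply: jet_kind.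
rewrite (det_col_multilinear (fun i j k => (kind_coef (t j) i k *: kind_row (t j) ^+ i)
       * (kind_col (t j) ^+ k * (u j)^`(k)))).
apply: big_ind => // f _.
pose M : 'M[{poly R}]_n := \matrix_(i, j) (kind_coef (t j) i (f j) *: kind_row (t j) ^+ i).
have -> : \matrix_(i, j) ((kind_coef (t j) i (f j) *: kind_row (t j) ^+ i)
       * (kind_col (t j) ^+ f j * (u j)^`(f j)))
   = \matrix_(i, j) (M i j * (kind_col (t j) ^+ f j * (u j)^`(f j))) :> 'M[{poly R}]_n.
  by apply/matrixP => i j; rewrite !mxE.
rewrite det_col_scale.
(* Two columns of the same kind whose polynomials are differentiated equally
   often are proportional. *)
case: (boolP [exists j, exists k, [&& j != k, t j == t k & f j == f k]]) => [|injf].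
  case/existsP=> j /existsP[k /and3P[jk /eqP tjk /eqP fjk]].
  rewrite -det_tr (@determinant_alternate _ _ _ j k) ?mul0r// => i.
  by rewrite !mxE tjk fjk.
have {}injf j k : t j = t k -> f j = f k -> j = k.
  move=> tjk fjk; apply: contraNeq injf => jk.
  by apply/existsP; exists j; apply/existsP; exists k; rewrite jk tjk fjk !eqxx.
rewrite det_col_expand mulr_suml; apply: big_ind => // s _.
under eq_bigr do rewrite mxE.
rewrite scaler_prod -scalerAr -scalerAl.
(* An untwisted column has a Kronecker coefficient, so only terms with [s j = f j] survive there.
   This is what lets one column count [s j] for both factors. *)
case: (boolP [exists j, (t j == Untwisted) && (s j != f j)])
  => [/existsP[j /andP[/eqP tj sf]]|sf].
  by rewrite (bigD1 j)//= tj/= val_eqE (negPf sf) mul0r scale0r.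
have {}sf j : t j = Untwisted -> s j = f j.
  by move=> tj; apply: contraNeq sf => sf; apply/existsP; exists j; rewrite tj eqxx.
pose al j : nat := if t j == TypeI then f j else s j.
pose be j : nat := if t j == TypeII then f j else s j.
have albe j : (al j + be j = s j + f j)%N.
  by rewrite /al /be; case tj: (t j) => //=; rewrite ?(sf _ tj)// addnC.
have h1 : (e1 <= \sum_j al j)%N.
  rewrite (bigID (fun j => t j == TypeI))/= leq_add//.
    under eq_bigr => j tj do rewrite /al tj.
    apply: (leq_sum_inj (P := [pred j | t j == TypeI])) => j k /eqP tj /eqP tk /val_inj.
    by apply: injf; rewrite tj tk.
  under eq_bigr => j tj do rewrite /al (negPf tj).
  exact: leq_sum_perm.
have h2 : (e2 <= \sum_j be j)%N.
  rewrite /e2 addnC (bigID (fun j => t j == TypeII))/= leq_add//.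
    under eq_bigr => j tj do rewrite /be tj.
    apply: (leq_sum_inj (P := [pred j | t j == TypeII])) => j k /eqP tj /eqP tk /val_inj.
    by apply: injf; rewrite tj tk.
  under eq_bigr => j tj do rewrite /be (negPf tj).
  exact: leq_sum_perm.
have E : (\prod_j kind_row (t j) ^+ s j) * (\prod_j (kind_col (t j) ^+ f j * (u j)^`(f j)))
    = a ^+ (\sum_j al j) * b ^+ (\sum_j be j) * \prod_j (u j)^`(f j).
  rewrite -!prodrXr -!big_split/=; apply: eq_bigr => j _.
  rewrite /al /be; case tj: (t j) => /=; first by ring.
    by ring.
  by rewrite -(sf _ tj) expr1n exprMn; ring.
set C := \prod_j kind_coef _ _ _.
exists (((-1) ^+ s * C) *: (a ^+ (\sum_j al j - e1) * b ^+ (\sum_j be j - e2)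
   * \prod_j (u j)^`(f j))); split.
  rewrite -[_ * _ * \prod_j (_ * _)]mulrA E.
  rewrite -{1}(subnK h1) -{1}(subnK h2) !exprD -!mul_polyC polyCM.
  have -> : ((-1) ^+ s)%:P = (-1) ^+ s :> {poly R} by rewrite polyC_exp polyCN.
  have H (A A' B B' U S T : {poly R}) :
    T * (S * (A' * A * (B' * B) * U)) = A * B * (S * T * (A' * B' * U)) by ring.
  exact: H.
have dU : deg_le (\prod_j (u j)^`(f j)) (\sum_j ((deg j)%:Z - (f j)%:Z)).
  by apply: deg_le_prod => j; apply/deg_le_derivn/deg_le_size/ud.
apply: deg_leZ.
apply: (deg_le_trans _ (deg_leM (deg_leM (deg_leXn a1) (deg_leXn b1)) dU)).
(* The factors bring degree [\sum_j (s j + f j)] and the derivatives remove [\sum_j f j]; what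
   remains is [\sum_j s j = 'C(n, 2)]. *)
rewrite !mul1r big_split/= -!(big_morph _ PoszD (erefl _)) sumrN.
rewrite -!(big_morph _ PoszD (erefl _)).
have := sum_perm_ord s.
have : (\sum_j al j + \sum_j be j = \sum_(j < n) s j + \sum_(j < n) f j)%N.
  by rewrite -!big_split/=; apply: eq_bigr => j _; exact: albe.
move: h1 h2; set x := (\sum_j al j)%N; set y := (\sum_j be j)%N.
set z := (\sum_(j < n) s j)%N; set w := (\sum_(j < n) f j)%N; set v := (\sum_j deg j)%N.
clear; move: e1 e2 => e1 e2; lia.
Qed.
End Jets.

(** * Jets as numerators of twisted derivatives *)

Section JetBridge.
Variables (R K : fieldType) (d : {additive K -> K}) (iota : {rmorphism {poly R} -> K}).
Hypothesis dM : forall x y, d (x * y) = d x * y + x * d y.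
Hypothesis d_iota : forall p, d (iota p) = iota p^`().
Variable c : {poly R}.
Hypothesis c0 : iota c != 0.

Lemma deriv_exp_iota i : d (iota c ^+ i) = i%:R * iota c^`() * iota c ^+ i / iota c.
Proof.
elim: i => [|i IH]; first by rewrite expr0 (deriv1 dM) !mul0r.
rewrite exprS dM IH d_iota -[i.+1%:R]natr1.
by field.
Qed.

Lemma iter_twisted_deriv_jet w u i :
  iter i (twisted_deriv d (iota w / iota c)) (iota u) = iota (jet c w u i) / iota c ^+ i.
Proof.
elim: i => [|i IH]; first by rewrite expr0 divr1.
have ci : iota c ^+ i != 0 by rewrite expf_neq0.
rewrite iterS IH tdE dM derivV// deriv_exp_iota d_iota/=.
rewrite rmorphD !rmorphM rmorphB rmorphMn/= [iota c ^+ i.+1]exprS.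
move: (iota w) (iota (jet c w u i)) (iota (jet c w u i)^`()) (iota c^`()) => W J J' C'.
rewrite -[C' *+ i]mulr_natr; move: (i%:R) (iota c ^+ i) ci => n e e0.
by field; apply/andP.
Qed.

Lemma twisted_wronskian_jet (T : Type) (x0 : T) (l : seq T) (w u : T -> {poly R}) :
  twisted_wronskian d [seq (iota (w x) / iota c, iota (u x)) | x <- l]
  = iota (\det (\matrix_(i < size l, j < size l)
             jet c (w (nth x0 l j)) (u (nth x0 l j)) i)) / iota c ^+ 'C(size l, 2).
Proof.
rewrite (twisted_wronskianE d (size_map _ l)).
rewrite -det_map_mx mulrC -bin2_sum big_mkord -prodrXr -prodfV -det_row_scale.
congr (\det _); apply/matrixP => i j; rewrite !mxE (nth_map x0)//=.
by rewrite iter_twisted_deriv_jet mulrC.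
Qed.
End JetBridge.

(** * Wronskians of the seed functions *)

Section SystemColumns.
Variable R : realType.
Implicit Types (s : system R) (A D : index_pair) (x : R).
Local Notation half := (2%:R^-1 : R).

(* The weight of the seeds of type I (resp. II) is singular only at the zero of
   [factI s] (resp. [factII s]). *)
Definition factI s : {poly R} :=
  match s with Laguerre _ => 1 | Jacobi _ _ => 1 + 'X end.
Definition factII s : {poly R} :=
  match s with Laguerre _ => 'X | Jacobi _ _ => 1 - 'X end.
Definition slopeI s : R := match s with Laguerre _ => 0 | Jacobi _ _ => 1 end.
Definition slopeII s : R := match s with Laguerre _ => 1 | Jacobi _ _ => -1 end.
(* [Xi_factor] and [P_factor] are built from [factI s / normal s] and
   [factII s / normal s]. *)
Definition normal s : R := match s with Laguerre _ => 1 | Jacobi _ _ => 2 end.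
(* Log-derivatives: the weight of type I has [expoI s / factI s], that of type II
   [expoII s / factII s]. *)
Definition expoI s : R := match s with Laguerre _ => 1 | Jacobi _ h => half - h end.
Definition expoII s : R :=
  match s with Laguerre g => half - g | Jacobi g _ => - (half - g) end.

Definition weight s (k : column_kind) x : R :=
  match k, s with
  | TypeI, Laguerre _ => expR x
  | TypeI, Jacobi _ h => ((1 + x) / 2%:R) `^ (half - h)
  | TypeII, Laguerre g => x `^ (half - g)
  | TypeII, Jacobi g _ => ((1 - x) / 2%:R) `^ (half - g)
  | Untwisted, _ => 1
  end.

Definition seed_polyI s v : {poly R} :=
  match s with
  | Laguerre g => laguerre (g - half) v \Po (- 'X)
  | Jacobi g h => jacobi (g - half) (half - h) v
  end.
Definition seed_polyII s v : {poly R} :=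
  match s with
  | Laguerre g => laguerre (half - g) v
  | Jacobi g h => jacobi (half - g) (h - half) v
  end.

Local Notation twist s := (kind_twist (factI s) (factII s) (expoI s) (expoII s)).

Definition column_fun s (q : column_kind * {poly R}) x : R := weight s q.1 x * q.2.[x].

Definition columns s A : seq (column_kind * {poly R}) :=
  [seq (TypeI, seed_polyI s v) | v <- idxI A] ++ [seq (TypeII, seed_polyII s v) | v <- idxII A].

Lemma c2E s : c2 s = factI s * factII s.
Proof. by case: s => /= *; ring. Qed.

Lemma deriv_factI s : (factI s)^`() = (slopeI s)%:P.
Proof. by case: s => /= *; rewrite -[1]/(1%:P) ?derivD ?derivX ?derivC ?add0r. Qed.

Lemma deriv_factII s : (factII s)^`() = (slopeII s)%:P.
Proof.
by case: s => /= *; rewrite ?derivB ?derivX ?derivC -?[1]/(1%:P) ?derivC ?sub0r// polyCN.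
Qed.

Lemma seedsE s A : seeds s A = map (column_fun s) (columns s A).
Proof.
rewrite /seeds /columns map_cat -!map_comp; congr (_ ++ _); apply: eq_map => v.
  by apply/funext => x; case: s => /= *; rewrite /column_fun/= ?horner_comp ?hornerN ?hornerX.
by apply/funext => x; case: s.
Qed.

Lemma seeds_rconsE s A n : rcons (seeds s A) (horner (base_poly s n)) =
  map (column_fun s) (rcons (columns s A) (Untwisted, base_poly s n)).
Proof.
rewrite map_rcons -seedsE; congr rcons.
by apply/funext => x; rewrite /column_fun/= mul1r.
Qed.

Lemma c2_gt0 s x : domain s x -> 0 < (c2 s).[x].
Proof.
case: s => [g|g h] /=; first by rewrite hornerX.
by rewrite !hornerE => /andP[x1 x2]; nra.
Qed.

Lemma powRB1 (y e : R) : 0 < y -> y `^ (e - 1) = y `^ e / y.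
Proof. by move=> y0; rewrite powRD ?(gt_eqF y0) ?implybT// powR_inv1// ltW. Qed.

Lemma is_derive_weight s k x : domain s x ->
  is_derive x 1 (weight s k) (weight s k x * ((twist s k).[x] / (c2 s).[x])).
Proof.
move=> dx; have := c2_gt0 dx; move: dx; case: s k => [g|g h] [] /=.
- move=> x0; rewrite scale1r hornerX => _; rewrite divff ?gt_eqF// mulr1.
  exact: is_derive_expR.
- move=> x0; rewrite !hornerE => _.
  apply: (is_derive_eq (is_derive1_powR (half - g) x0)).
  by rewrite powRB1//= mulr1 mulrCA mulrA.
- by move=> _ _; rewrite horner0 mul0r mulr0; exact: is_derive_cst.
- move=> /andP[x1 x2]; rewrite !hornerE => c0.
  have x0 : 0 < (1 + x) / 2 by lra.
  have dl : is_derive x 1 (fun y : R => (1 + y) / 2) (2^-1).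
    by apply: is_derive_eq; rewrite !scaler0 !add0r /GRing.scale/= ?mulrN1 ?mulr1.
  change (weight (Jacobi g h) TypeI)
    with ((@powR R ^~ (half - h)) \o (fun y : R => (1 + y) / 2)).
  apply: (is_derive_eq (@is_derive1_comp R _ (fun y : R => (1 + y) / 2) _ _ _
    (is_derive1_powR (half - h) x0) dl)).
  by rewrite powRB1//=; set P := _ `^ _; field; rewrite !gt_eqF//; nra.
- move=> /andP[x1 x2]; rewrite !hornerE => c0.
  have x0 : 0 < (1 - x) / 2 by lra.
  have dl : is_derive x 1 (fun y : R => (1 - y) / 2) (- 2^-1).
    by apply: is_derive_eq; rewrite !scaler0 !add0r /GRing.scale/= ?mulrN1 ?mulr1.
  change (weight (Jacobi g h) TypeII)
    with ((@powR R ^~ (half - g)) \o (fun y : R => (1 - y) / 2)).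
  apply: (is_derive_eq (@is_derive1_comp R _ (fun y : R => (1 - y) / 2) _ _ _
    (is_derive1_powR (half - g) x0) dl)).
  by rewrite powRB1//=; set P := _ `^ _; field; rewrite !gt_eqF//; nra.
- by move=> _ _; rewrite horner0 mul0r mulr0; exact: is_derive_cst.
Qed.
Lemma near_domain s x : domain s x -> \forall y \near x, domain s y.
Proof.
case: s => [g|g h] /=; first exact: lt_nbhsr.
move=> /andP[x1 x2]; near=> y; apply/andP; split; near: y.
  exact: lt_nbhsr.
exact: lt_nbhsl.
Unshelve. all: by end_near.
Qed.

Lemma derive1n_column s q i x : domain s x ->
  derive1n i (column_fun s q) x
  = weight s q.1 x * ((jet (c2 s) (twist s q.1) q.2 i).[x] / (c2 s).[x] ^+ i).
Proof.
case: q => k u /=; set w := twist s k; set c := c2 s.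
elim: i x => [|i IH] x dx; first by rewrite derive1n0 expr0 divr1.
rewrite derive1nS derive1E.
pose J := jet c w u i; pose E := c ^+ i.
(* The induction hypothesis is needed on a neighbourhood of [x], which exists because the domain is
   open. *)
rewrite (@near_eq_derive _ _ _ _ (fun y => weight s k y * (J.[y] * (E.[y])^-1))); last first.
  by near=> y; rewrite IH ?horner_exp//; near: y; exact: near_domain.
have c0 : c.[x] != 0 by rewrite gt_eqF// c2_gt0.
have E0 : E.[x] != 0 by rewrite horner_exp expf_neq0.
have D1 := is_derive_weight k dx.
have D2 := is_deriveM (is_derive_poly J x) (is_deriveV E0 (is_derive_poly E x)).
etransitivity; first exact: (@derive_val _ _ _ _ _ _ _ (is_deriveM D1 D2)).
rewrite /GRing.scale/= -/c -/w -/J.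
rewrite hornerD !hornerM hornerD hornerN hornerMn.
have eE : E^`().[x] = i%:R * c^`().[x] * c.[x] ^+ i / c.[x].
  rewrite /E deriv_exp hornerMn hornerM horner_exp -mulr_natl.
  by case: (i) => [|n]; rewrite ?mul0r// exprS/=; field.
rewrite eE (_ : (_ * _)%R x = J.[x] * E.[x]^-1)// [c.[x] ^+ i.+1]exprS -mulr_natl.
have -> : c.[x] ^+ i = E.[x] by rewrite horner_exp.
by field; apply/andP.
Unshelve. all: by end_near.
Qed.

(** * From analytic Wronskians to jet determinants *)

Local Notation col := (column_kind * {poly R})%type.
Local Notation col0 := (Untwisted, 0 : {poly R}).

Definition jet_det s (l : seq col) : {poly R} :=
  \det (\matrix_(i < size l, j < size l)
          jet (c2 s) (twist s (nth col0 l j).1) (nth col0 l j).2 i).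

Lemma wronskianE n (fs : seq (R -> R)) x : size fs = n ->
  wronskian fs x = \det (\matrix_(i < n, j < n) derive1n i (nth (fun=> 0) fs j) x).
Proof. by move<-. Qed.

Lemma wronskian_columns s (l : seq col) x : domain s x ->
  wronskian (map (column_fun s) l) x
  = \prod_(q <- l) weight s q.1 x * ((jet_det s l).[x] / (c2 s).[x] ^+ 'C(size l, 2)).
Proof.
move=> dx.
have -> : wronskian (map (column_fun s) l) x =
    \det (\matrix_(i < size l, j < size l) derive1n i (column_fun s (nth col0 l j)) x).
  rewrite (wronskianE _ (size_map (column_fun s) l)); congr (\det _).
  by apply/matrixP => i j; rewrite !mxE (nth_map col0).
pose M : 'M[R]_(size l) :=
  \matrix_(i, j) (jet (c2 s) (twist s (nth col0 l j).1) (nth col0 l j).2 i).[x].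
have -> : \matrix_(i < size l, j < size l) derive1n i (column_fun s (nth col0 l j)) x
  = \matrix_(i, j) ((\matrix_(i, j) ((c2 s).[x]^-1 ^+ i * M i j)) i j
                    * weight s (nth col0 l j).1 x).
  apply/matrixP => i j; rewrite !mxE derive1n_column// exprVn mulrC.
  by rewrite [X in X * _]mulrC.
rewrite det_col_scale det_row_scale mulrC prodrXr -(big_mkord xpredT id) bin2_sum.
rewrite (big_nth col0) big_mkord exprVn; congr (_ * _).
rewrite mulrC; congr (_ / _); rewrite /jet_det -horner_evalE -det_map_mx.
by congr (\det _); apply/matrixP => i j; rewrite !mxE.
Qed.

Lemma poly_eq_domain s (p q : {poly R}) :
  (forall x, domain s x -> p.[x] = q.[x]) -> p = q.
Proof.
move=> pq; apply/eqP; rewrite -subr_eq0; apply/eqP.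
(* The points [1 / (k + 2)] lie strictly between 0 and 1, hence in the domain of either system. *)
pose pts := [seq (k.+2%:R : R)^-1 | k <- iota 0 (size (p - q))].
apply: (@roots_geq_poly_eq0 _ _ pts).
- apply/allP => _ /mapP[k _ ->]; rewrite rootE hornerD hornerN pq ?subrr//.
  have k0 : 0 < (k.+2%:R : R)^-1 by rewrite invr_gt0 ltr0n.
  have k1 : (k.+2%:R : R)^-1 < 1 by rewrite invf_lt1 ?ltr0n// ltr1n.
  by case: s {pq} => //= g h; rewrite k1 (lt_trans _ k0)// oppr_lt0.
- rewrite map_inj_uniq ?iota_uniq// => i j /invr_inj/eqP.
  by rewrite eqr_nat => /eqP[].
- by rewrite size_map size_iota.
Qed.

Lemma poly_onE s f (p : {poly R}) :
  (forall x, domain s x -> p.[x] = f x) -> poly_on (domain s) f = p.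
Proof.
move=> pf; rewrite /poly_on; apply: xget_subset1 => // q r /= qf rf.
by apply: (@poly_eq_domain s) => x dx; rewrite qf// rf.
Qed.

(** The exponents of the prefactors are chosen for this: the real power carried by [m] weights is
    cancelled, leaving an integer power. *)
Lemma powR_pow_cancel (y e : R) (k m : nat) : 0 < y ->
  (y `^ e) ^+ m * y `^ ((k%:R - e) * m%:R) = y ^+ (k * m).
Proof.
move=> y0; rewrite -powR_mulrn ?powR_ge0// -powRrM -powRD ?(gt_eqF y0) ?implybT//.
by rewrite -mulrDl subrKC -natrM powR_mulrn// ltW.
Qed.

Lemma expR_pow_cancel m x : expR x ^+ m * expR (- m%:R * x) = 1.
Proof. by rewrite -expRM_natl -expRD mulNr subrr expR0. Qed.
Lemma card_nth (T : Type) (x0 : T) (l : seq T) (P : pred T) :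
  #|[pred j : 'I_(size l) | P (nth x0 l j)]| = count P l.
Proof.
rewrite -sum1_card -sum1_count (big_nth x0) big_mkord.
by apply: eq_bigl => j; rewrite !inE.
Qed.

Definition kind_size (k : column_kind) (l : seq col) : nat := count (fun q => q.1 == k) l.
Definition expo_factI (l : seq col) : nat :=
  ('C(kind_size TypeI l, 2) + 'C(size l - kind_size TypeI l, 2))%N.
Definition expo_factII (l : seq col) : nat :=
  ('C(size l - kind_size TypeII l, 2) + 'C(kind_size TypeII l, 2))%N.

Lemma deg_le_factI s : deg_le (factI s) 1.
Proof.
apply: (deg_le_size (n := 1)); case: s => /= *; first by rewrite size_poly1.
by rewrite addrC -[1]/(1%:P) size_XaddC.
Qed.

Lemma deg_le_factII s : deg_le (factII s) 1.
Proof.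
apply: (deg_le_size (n := 1)); case: s => /= *; first by rewrite size_polyX.
by rewrite -opprB size_polyN -[1]/(1%:P) size_XsubC.
Qed.

Lemma jet_det_columns s (l : seq col) :
  exists Q, jet_det s l = factI s ^+ expo_factI l * factII s ^+ expo_factII l * Q
  /\ deg_le Q ((\sum_(q <- l) (size q.2).-1 + 'C(size l, 2))%N%:Z
               - (expo_factI l)%:Z - (expo_factII l)%:Z).
Proof.
have neq k : #|[pred j : 'I_(size l) | (nth col0 l j).1 != k]| = (size l - kind_size k l)%N.
  rewrite (card_nth col0 l (fun q => q.1 != k)) /kind_size.
  by rewrite -(count_predC (fun q => q.1 == k) l) addKn.
have [Q []] := jet_det_factor (expoI s) (expoII s) (deriv_factI s) (deriv_factII s)
  (fun j : 'I_(size l) => (nth col0 l j).1) (deg_le_factI s) (deg_le_factII s)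
  (fun j : 'I_(size l) => leqSpred (size (nth col0 l j).2)).
rewrite !neq !(card_nth col0 l (fun q => q.1 == _)) -/(kind_size _ _) -c2E => eQ dQ.
exists Q; split => //; rewrite (big_nth col0) big_mkord.
exact: dQ.
Qed.

Lemma weight_prod_columns s A x : \prod_(q <- columns s A) weight s q.1 x =
  weight s TypeI x ^+ size (idxI A) * weight s TypeII x ^+ size (idxII A).
Proof.
rewrite /columns big_cat !big_map/= !big_const_seq !iter_mulr_1.
by rewrite !count_predT.
Qed.

Lemma size_columns s A : size (columns s A) = (size (idxI A) + size (idxII A))%N.
Proof. by rewrite size_cat !size_map. Qed.

Lemma kind_size_columns s A :
  (kind_size TypeI (columns s A) = size (idxI A)) *
  (kind_size TypeII (columns s A) = size (idxII A)).
Proof.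
rewrite /kind_size /columns !count_cat !count_map; split.
  rewrite (@eq_count _ _ predT)// (@eq_count _ (preim _ _) pred0)//.
  by rewrite count_predT count_pred0 addn0.
by rewrite (@eq_count _ _ pred0)// (@eq_count _ (preim _ _) predT)// count_predT count_pred0.
Qed.

(** It gives the powers still missing after [jet_det_columns]: [p * q] of each factor for [Xi]. For
    [P_poly] the untwisted column joins the columns not of type I when counting [factI], and those
    not of type II when counting [factII], whence [q.+1 * p] and [p.+1 * q]. The prefactors supply
    exactly these. *)
Lemma bin2D p q : ('C(p, 2) + 'C(q, 2) + p * q = 'C(p + q, 2))%N.
Proof.
elim: p => [|p IH]; first by rewrite add0n addn0.
by rewrite addSn !binS !bin1 -IH; lia.
Qed.

Lemma horner1 x : (1 : {poly R}).[x] = 1.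
Proof. by rewrite -[1]/(1%:P) hornerC. Qed.

Lemma Xi_factorE s A x (p := size (idxI A)) (q := size (idxII A)) : domain s x ->
  weight s TypeI x ^+ p * weight s TypeII x ^+ q * Xi_factor s A x
  = ((factI s).[x] / normal s) ^+ (p * q) * ((factII s).[x] / normal s) ^+ (p * q).
Proof.
rewrite /Xi_factor -/p -/q; case: s => [g|g h] /=.
  move=> x0; rewrite hornerX horner1 !divr1 expr1n mul1r.
  rewrite -(powR_pow_cancel (half - g) p q x0).
  by rewrite [_ `^ (_ * _) * _]mulrC mulrACA expR_pow_cancel mul1r opprB addrA.
move=> /andP[x1 x2].
rewrite !hornerD hornerN hornerX horner1.
have u0 : 0 < (1 - x) / 2 by lra.
have v0 : 0 < (1 + x) / 2 by lra.
have -> : ((1 + x) / 2) ^+ (p * q) =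
    ((1 + x) / 2) `^ (half - h) ^+ p * ((1 + x) / 2) `^ ((q%:R - (half - h)) * p%:R).
  by rewrite powR_pow_cancel// mulnC.
rewrite -(powR_pow_cancel (half - g) p q u0) !opprB !addrA.
by rewrite [_ `^ (_ * _) * _]mulrC mulrACA.
Qed.

Lemma P_factorE s A x (p := size (idxI A)) (q := size (idxII A)) : domain s x ->
  weight s TypeI x ^+ p * weight s TypeII x ^+ q * P_factor s A x
  = ((factI s).[x] / normal s) ^+ (q.+1 * p) * ((factII s).[x] / normal s) ^+ (p.+1 * q).
Proof.
have e (n : nat) (g : R) : n%:R + g + half = n.+1%:R - (half - g).
  by rewrite -[n.+1%:R]natr1; lra.
rewrite /P_factor -/p -/q; case: s => [g|g h] /=.
  move=> x0; rewrite hornerX horner1 !divr1 expr1n mul1r.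
  rewrite -(powR_pow_cancel (half - g) p.+1 q x0).
  by rewrite [_ `^ (_ * _) * _]mulrC mulrACA expR_pow_cancel mul1r e.
move=> /andP[x1 x2].
rewrite !hornerD hornerN hornerX horner1.
have u0 : 0 < (1 - x) / 2 by lra.
have v0 : 0 < (1 + x) / 2 by lra.
rewrite -(powR_pow_cancel (half - h) q.+1 p v0).
rewrite -(powR_pow_cancel (half - g) p.+1 q u0) !e.
by rewrite [_ `^ (_ * _) * _]mulrC mulrACA.
Qed.
Lemma normal_neq0 s : normal s != 0.
Proof. by case: s => /= *; rewrite ?oner_eq0// pnatr_eq0. Qed.

Lemma factII_neq0 s x : domain s x -> (factII s).[x] != 0.
Proof.
move=> /c2_gt0; rewrite c2E hornerM => c0.
by apply: contraL c0 => /eqP ->; rewrite mulr0 ltxx.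
Qed.

Lemma factI_neq0 s x : domain s x -> (factI s).[x] != 0.
Proof.
move=> /c2_gt0; rewrite c2E hornerM => c0.
by apply: contraL c0 => /eqP ->; rewrite mul0r ltxx.
Qed.

(* Common shape of [Xi] and [P_poly]: the power of the weights and of the
   factors of [c2] exactly compensates the one split off the determinant. *)
Lemma poly_on_jet_det s (l : seq col) (F : R -> R) (m1 m2 : nat) :
  (expo_factI l + m1 = 'C(size l, 2))%N -> (expo_factII l + m2 = 'C(size l, 2))%N ->
  (forall x, domain s x -> (\prod_(q <- l) weight s q.1 x) * F x
     = ((factI s).[x] / normal s) ^+ m1 * ((factII s).[x] / normal s) ^+ m2) ->
  let X := poly_on (domain s) (fun x => wronskian (map (column_fun s) l) x * F x) in
  jet_det s l * (factI s ^+ m1 * factII s ^+ m2)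
    = normal s ^+ (m1 + m2) *: X * c2 s ^+ 'C(size l, 2)
  /\ deg_le X ((\sum_(q <- l) (size q.2).-1 + m1)%N%:Z - (expo_factII l)%:Z).
Proof.
move=> e1 e2 wF X; have [Q [eQ dQ]] := jet_det_columns s l.
have g0 := normal_neq0 s.
(* On the domain the weights, the prefactor and the power of [c2] cancel the split-off factor, so
   the prescribed function is the cofactor [Q] up to a constant. *)
have eX : X = (normal s ^+ (m1 + m2))^-1 *: Q.
  apply: poly_onE => x dx; rewrite wronskian_columns// hornerZ.
  rewrite mulrAC wF// eQ c2E !hornerM !horner_exp !exprMn -{1}e1 -e2.
  rewrite !exprVn !(exprD _ _ m1) !(exprD _ _ m2).
  have a0 := factI_neq0 dx; have b0 := factII_neq0 dx.
  have := expf_neq0 m1 a0; have := expf_neq0 m2 b0.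
  have := expf_neq0 (expo_factI l) a0; have := expf_neq0 (expo_factII l) b0.
  have := expf_neq0 m1 g0; have := expf_neq0 m2 g0.
  move: (_ ^+ m1) (_ ^+ m2) (_ ^+ m1) (_ ^+ m2) (_ ^+ expo_factI l) (_ ^+ expo_factII l).
  move=> A B C D E G h1 h2 h3 h4 h5 h6.
  by field; rewrite h1 h2 h3 h4 h5 h6.
split.
  rewrite eX eQ c2E scalerA divff ?expf_neq0// scale1r exprMn -{1}e1 -e2.
  rewrite !(exprD _ _ m1) !(exprD _ _ m2).
  move: (_ ^+ m1) (_ ^+ m2) (_ ^+ expo_factI l) (_ ^+ expo_factII l) => A B C D; ring.
by rewrite eX; apply: deg_leZ; apply: deg_le_trans dQ; move: e1 e2; lia.
Qed.
Lemma size_laguerre (al : R) n : (size (laguerre al n) <= n.+1)%N.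
Proof.
apply: leq_trans (size_sum _ _ _) _; apply/bigmax_leqP => k _.
by apply: leq_trans (size_scale_leq _ _) _; rewrite size_polyXn.
Qed.

Lemma size_jacobi (al be : R) n : (size (jacobi al be n) <= n.+1)%N.
Proof.
apply: leq_trans (size_sum _ _ _) _; apply/bigmax_leqP => k _.
apply: leq_trans (size_scale_leq _ _) _; apply: leq_trans (size_poly_exp_leq _ _) _.
have -> : size (2%:R^-1 *: (1 - 'X) : {poly R}) = 2%N.
  by rewrite size_scale ?invr_eq0 ?pnatr_eq0// -opprB size_polyN -[1]/(1%:P) size_XsubC.
by rewrite mul1n; exact: ltn_ord.
Qed.

Lemma leq_pred_succ m n : (m <= n.+1)%N -> (m.-1 <= n)%N.
Proof. by case: m. Qed.

Lemma size_seed_polyI s v : ((size (seed_polyI s v)).-1 <= v)%N.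
Proof.
apply: leq_pred_succ; case: s => [g|g h]; last exact: size_jacobi.
apply: leq_trans (size_comp_poly_leq _ _) _.
by rewrite size_polyN size_polyX muln1 ltnS; apply/leq_pred_succ/size_laguerre.
Qed.

Lemma size_seed_polyII s v : ((size (seed_polyII s v)).-1 <= v)%N.
Proof.
by apply: leq_pred_succ; case: s => [g|g h]; [exact: size_laguerre|exact: size_jacobi].
Qed.

Lemma size_base_poly s n : ((size (base_poly s n)).-1 <= n)%N.
Proof.
by apply: leq_pred_succ; case: s => [g|g h]; [exact: size_laguerre|exact: size_jacobi].
Qed.

Lemma sum_deg_columns s A :
  (\sum_(q <- columns s A) (size q.2).-1 <= sumn (idxI A) + sumn (idxII A))%N.
Proof.
rewrite /columns big_cat !big_map/= !sumnE leq_add//; apply: leq_sum => v _.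
  exact: size_seed_polyI.
exact: size_seed_polyII.
Qed.

Lemma Xi_jet_det s A (p := size (idxI A)) (q := size (idxII A)) :
  jet_det s (columns s A) * c2 s ^+ (p * q)
  = normal s ^+ (p * q + p * q) *: Xi s A * c2 s ^+ 'C(p + q, 2).
Proof.
have h1 : (expo_factI (columns s A) + p * q = 'C(size (columns s A), 2))%N.
  by rewrite /expo_factI size_columns !kind_size_columns addKn bin2D.
have h2 : (expo_factII (columns s A) + p * q = 'C(size (columns s A), 2))%N.
  by rewrite /expo_factII size_columns !kind_size_columns addnK bin2D.
have wF x : domain s x -> \prod_(r <- columns s A) weight s r.1 x * Xi_factor s A x
    = ((factI s).[x] / normal s) ^+ (p * q) * ((factII s).[x] / normal s) ^+ (p * q).
  by move=> dx; rewrite weight_prod_columns Xi_factorE.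
have [+ _] := poly_on_jet_det h1 h2 wF.
by rewrite -exprMn -c2E -seedsE size_columns.
Qed.

Lemma P_jet_det s A n (p := size (idxI A)) (q := size (idxII A)) :
  jet_det s (rcons (columns s A) (Untwisted, base_poly s n))
    * (factI s ^+ (q.+1 * p) * factII s ^+ (p.+1 * q))
  = normal s ^+ (q.+1 * p + p.+1 * q) *: P_poly s A n * c2 s ^+ 'C((p + q).+1, 2)
  /\ deg_le (P_poly s A n) ((sumn (idxI A) + sumn (idxII A) + n + p * q)%N%:Z
        - 'C(p, 2)%:Z - 'C(q, 2)%:Z).
Proof.
set l := rcons _ _.
have sl : size l = (p + q).+1 by rewrite size_rcons size_columns.
have kl : (kind_size TypeI l = p) * (kind_size TypeII l = q).
  have kr k : kind_size k l = (kind_size k (columns s A) + (Untwisted == k))%N.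
    by rewrite /kind_size /l -cats1 count_cat/= addn0.
  by rewrite !kr !kind_size_columns !addn0.
have h1 : (expo_factI l + q.+1 * p = 'C(size l, 2))%N.
  rewrite /expo_factI sl !kl -(addnS p q) addKn [(_ * p)%N]mulnC bin2D.
  by [].
have h2 : (expo_factII l + p.+1 * q = 'C(size l, 2))%N.
  by rewrite /expo_factII sl !kl -addSn addnK bin2D.
have wF x : domain s x -> \prod_(r <- l) weight s r.1 x * P_factor s A x
    = ((factI s).[x] / normal s) ^+ (q.+1 * p) * ((factII s).[x] / normal s) ^+ (p.+1 * q).
  move=> dx; rewrite /l big_rcons/= mulr1 -P_factorE//.
  by rewrite weight_prod_columns.
have [] := poly_on_jet_det h1 h2 wF.
rewrite -seeds_rconsE sl -/(P_poly s A n) => eP dP; split=> //.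
apply: deg_le_trans dP; rewrite /expo_factII sl !kl -addSn addnK.
have := sum_deg_columns s A; rewrite {1}/l big_rcons/=.
(* The extra [p] in [q.+1 * p] is cancelled by the one in ['C(p.+1, 2) = 'C(p, 2) + p]. *)
have := size_base_poly s n; rewrite binS bin1 mulSn [(q * p)%N]mulnC.
move: (p * q)%N 'C(p, 2) 'C(q, 2) (\sum_(j <- _) _)%N ((size _).-1) => a b c e f.
by clear; lia.
Qed.
End SystemColumns.

(** * Differential equations of the seed polynomials *)

Section ClassicalODE.
Variable F : realFieldType.
Implicit Types al be : F.

Lemma pochhammerSr al n : pochhammer al n.+1 = pochhammer al n * (al + n%:R).
Proof. by rewrite /pochhammer big_ord_recr. Qed.

Lemma pochhammerSl al n : pochhammer al n.+1 = al * pochhammer (al + 1) n.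
Proof.
rewrite /pochhammer big_ord_recl addr0; congr (_ * _); apply: eq_bigr => i _.
by rewrite lift0 -natr1 addrAC addrA.
Qed.

Lemma laguerre_ode al n :
  'X * (laguerre al n)^`(2) + ((al + 1)%:P - 'X) * (laguerre al n)^`()
    + n%:R *: laguerre al n = 0.
Proof.
pose l k : F := (-1) ^+ k * pochhammer (al + k%:R + 1) (n - k) / ((n - k)`!%:R * k`!%:R).
have -> : laguerre al n = \poly_(k < n.+1) l k by rewrite poly_def.
set p := \poly_(k < n.+1) l k.
(* The recurrence avoids dividing by [al + k + 1], which may vanish. At [k = n] the factor [k - n]
   matches the truncation of the sum. *)
have rec k : (k.+1%:R * (al + k%:R + 1)) * p`_k.+1 = (k%:R - n%:R) * p`_k.
  rewrite !coef_poly !ltnS; case: (ltngtP k n) => kn.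
  - rewrite /l; have -> : (n - k = (n - k.+1).+1)%N by lia.
    have -> : n%:R = k%:R + (n - k.+1)%:R + 1 :> F.
      by rewrite -natrD natr1; congr (_%:R); lia.
    rewrite pochhammerSl !factS !natrM -[(n - k.+1).+1%:R]natr1 -[k.+1%:R]natr1 exprS.
    rewrite (_ : al + (k%:R + 1) + 1 = al + k%:R + 1 + 1); last by ring.
    have k0 : (k%:R + 1 : F) != 0 by rewrite natr1 pnatr_eq0.
    have m0 : ((n - k.+1)%:R + 1 : F) != 0 by rewrite natr1 pnatr_eq0.
    have f0 m : (m`!%:R : F) != 0 by rewrite pnatr_eq0 -lt0n fact_gt0.
    move: (f0 (n - k.+1)%N) (f0 k) => f1 f2.
    by field; rewrite f1 f2 k0 m0.
  - by rewrite !mulr0.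
  - by rewrite kn subrr mulr0 mul0r.
apply/polyP => k; rewrite mulrBl !coefD coefN coefZ coefCM !coefXM coef0.
case: k => [|k] /=.
  by rewrite !coef_deriv subr0 add0r mulr1n; have := rec 0%N; rewrite addr0 mul1r; lra.
rewrite !coef_deriv.
have := rec k.+1; rewrite -[k.+2%:R]natr1 -[k.+1%:R]natr1 => H.
lra.
Qed.

Lemma jacobi_ode al be n :
  (1 - 'X^2) * (jacobi al be n)^`(2)
    + ((be - al)%:P - (al + be + 2) *: 'X) * (jacobi al be n)^`()
    + (n%:R * (n%:R + al + be + 1)) *: jacobi al be n = 0.
Proof.
pose z : {poly F} := 2%:R^-1 *: (1 - 'X).
pose l k : F := pochhammer (- n%:R) k * pochhammer (n%:R + al + be + 1) k
       * pochhammer (al + k%:R + 1) (n - k) / (n`!%:R * k`!%:R).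
pose p := \poly_(k < n.+1) l k.
have -> : jacobi al be n = p \Po z.
  rewrite /p poly_def raddf_sum /=; apply: eq_bigr => k _.
  by rewrite comp_polyZ comp_Xn_poly.
have rec k : (k.+1%:R * (al + k%:R + 1)) * p`_k.+1
    = (k%:R - n%:R) * (n%:R + k%:R + al + be + 1) * p`_k.
  rewrite !coef_poly !ltnS; case: (ltngtP k n) => kn.
  - rewrite /l; have -> : (n - k = (n - k.+1).+1)%N by lia.
    rewrite (pochhammerSl (al + k%:R + 1)) !pochhammerSr factS natrM -[k.+1%:R]natr1.
    rewrite (_ : al + (k%:R + 1) + 1 = al + k%:R + 1 + 1); last by ring.
    have k0 : (k%:R + 1 : F) != 0 by rewrite natr1 pnatr_eq0.
    have f0 m : (m`!%:R : F) != 0 by rewrite pnatr_eq0 -lt0n fact_gt0.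
    move: (f0 n) (f0 k) => f1 f2.
    by field; rewrite f1 f2 k0.
  - by rewrite !mulr0.
  - by rewrite kn subrr mulr0 !mul0r.
(* The hypergeometric equation in the variable [z = (1 - 'X) / 2], read off the recurrence;
   composition with [z] turns it into the Jacobi equation. *)
have ode : ('X - 'X^2) * p^`(2) + ((al + 1)%:P - (al + be + 2) *: 'X) * p^`()
    + (n%:R * (n%:R + al + be + 1)) *: p = 0.
  apply/polyP => k; rewrite !mulrBl -scalerAl.
  rewrite !(coefD, coefN, coefZ, coefCM, coefXM, coefXnM) coef0.
  case: k => [|[|k]] /=.
  - by rewrite !coef_deriv; have := rec 0%N; rewrite addr0 mul1r; lra.
  - by rewrite !coef_deriv; have := rec 1%N; lra.
  rewrite !subSS subn0 !coef_deriv.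
  have := rec k.+2; rewrite -[k.+3%:R]natr1 -[k.+2%:R]natr1 -[k.+1%:R]natr1 => H.
  lra.
have z' : z^`() = (- 2%:R^-1)%:P.
  have d1 : (1 : {poly F})^`() = 0 by rewrite -polyC1 derivC.
  by rewrite derivZ derivB derivX d1 sub0r -mul_polyC mulrN1 -polyCN.
have xz : 'X = 1 - 2%:R *: z :> {poly F}.
  by rewrite scalerA divff ?pnatr_eq0// scale1r; ring.
have := congr1 (fun q => q \Po z) ode.
rewrite comp_poly0 !(comp_polyB, comp_polyD, comp_polyM, comp_polyZ, comp_polyC, comp_Xn_poly,
  comp_polyX) => oz.
rewrite /= !deriv_comp z' derivM derivC mulr0 addr0 deriv_comp z' -oz.
rewrite (_ : (- 2%:R^-1)%:P = - (2%:R^-1)%:P); last by rewrite polyCN.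
have xz2 : 'X^2 = (1 - 2%:R *: z) ^+ 2 by rewrite -xz.
rewrite xz2 -!mul_polyC xz -!mul_polyC.
have h2 : (2%:R^-1)%:P * 2%:R = 1 :> {poly F}.
  by rewrite -polyC_natr -polyCM mulVf ?pnatr_eq0.
rewrite !(polyCD, polyCB, polyCM, polyC_natr, polyCN) polyC1.
clear xz xz2 z' oz; clearbody z.
rewrite -/(p^`(2)); move: ((p^`())^`() \Po z) (p^`() \Po z) (p \Po z) => p2 p1 p0.
move: (2%:R^-1)%:P h2 al%:P be%:P => e h2 A B.
(* Here [e] stands for 1/2, and [ring] does not know [e * 2 = 1]; the occurrences of [e * 2] are
   displayed so that [h2] can remove them. *)
transitivity ((z - z * z) * p2 * (e * 2) ^+ 2
  + (A + 1 - (A + B + (1 + 1)) * z) * p1 * (e * 2)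
  + n%:R * (n%:R + A + B + 1) * p0); first by ring.
by rewrite h2; ring.
Qed.
End ClassicalODE.
Section SeedEigen.
Variable R : realType.
Implicit Types (s : system R).
Local Notation half := (2%:R^-1 : R).
Local Notation twist s := (kind_twist (factI s) (factII s) (expoI s) (expoII s)).

Definition column_poly s (k : column_kind) (v : nat) : {poly R} :=
  match k with
  | TypeI => seed_polyI s v | TypeII => seed_polyII s v | Untwisted => base_poly s v
  end.

Definition column_energy s (k : column_kind) (v : nat) : R :=
  match k with
  | TypeI => energyI s v | TypeII => energyII s v | Untwisted => energy s v
  end.

Lemma jet1E (c w u : {poly R}) : jet c w u 1 = c * u^`() + w * u.
Proof. by rewrite /= subr0. Qed.

Lemma jet2E (c w u : {poly R}) : jet c w u 2 =
  c * (c^`() * u^`() + c * u^`(2) + (w^`() * u + w * u^`()))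
  + (w - c^`()) * (c * u^`() + w * u).
Proof. by rewrite /= subr0 derivD !derivM. Qed.

(** The seeds come from discrete symmetries of the operator [c2 D^2 + c1 D]: conjugation by the
    weight amounts to [g -> 1 - g] for type II, [h -> 1 - h] for type I Jacobi and [x -> -x] for
    type I Laguerre. Each case is therefore a classical equation multiplied by [c2] up to sign. *)
Lemma jet_eigen s k v (u := column_poly s k v) (w := twist s k) :
  jet (c2 s) w u 2 + c1 s * jet (c2 s) w u 1
    + (column_energy s k v / 4%:R)%:P * (c2 s * u) = 0.
Proof.
have d1 : (1 : {poly R})^`() = 0 by rewrite -polyC1 derivC.
rewrite jet1E jet2E /u /w {u w}; case: s k => [g|g h] [] /=.
- have := congr1 (fun p => p \Po - 'X) (laguerre_ode (g - half) v).
  rewrite comp_poly0 !(comp_polyB, comp_polyD, comp_polyM, comp_polyZ, comp_polyC,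
    comp_polyX).
  rewrite scale1r !(deriv_comp, derivM, derivN, derivX, d1).
  have -> : g + half = g - half + 1 by field.
  have -> : - 4%:R * (g + v%:R + half) / 4%:R = - (g - half + 1 + v%:R) by field.
  move: (g - half) => al; move: (laguerre al v) => L /= ode.
  rewrite -[RHS](mulr0 (- 'X)) -[X in _ = _ * X]ode.
  rewrite -!mul_polyC !(polyCD, polyCN, polyC_natr) polyC1.
  by ring.
- have := laguerre_ode (half - g) v.
  rewrite derivZ derivX d1.
  have -> : g + half = 1 - (half - g) by field.
  have -> : - 4%:R * (g - v%:R - half) / 4%:R = v%:R + (half - g) by field.
  move: (half - g) => e; move: (laguerre e v) => L /= ode.
  rewrite -[RHS](mulr0 'X) -[X in _ = _ * X]ode.
  rewrite -!mul_polyC !(polyCD, polyCN, polyC_natr) polyC1 /=.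
  by ring.
- have := laguerre_ode (g - half) v.
  rewrite derivX deriv0.
  have -> : g + half = g - half + 1 by field.
  have -> : 4%:R * v%:R / 4%:R = v%:R :> R by field.
  move: (g - half) => al; move: (laguerre al v) => L /= ode.
  rewrite -[RHS](mulr0 'X) -[X in _ = _ * X]ode.
  rewrite -!mul_polyC !(polyCD, polyCN, polyC_natr) polyC1 /=.
  by ring.
- have := jacobi_ode (g - half) (half - h) v.
  rewrite derivZ !derivB derivX derivXn d1.
  have -> : h - g = - (half - h) - (g - half) by field.
  have -> : g + h + 1 = g - half - (half - h) + 2 by field.
  have -> : - 4%:R * (g + v%:R + half) * (h - v%:R - half) / 4%:R
    = (g - half + 1 + v%:R) * (half - h + v%:R) by field.
  move: (g - half) (half - h) => a e; move: (jacobi a e v) => L /= ode.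
  rewrite -[RHS](mulr0 (1 - 'X^2)) -[X in _ = _ * X]ode.
  rewrite -!mul_polyC !(polyCD, polyCN, polyCM, polyC_natr) polyC1 /=.
  by ring.
- have := jacobi_ode (half - g) (h - half) v.
  rewrite derivZ derivB derivD derivX derivXn d1.
  have -> : h - g = (h - half) + (half - g) by field.
  have -> : g + h + 1 = h - half - (half - g) + 2 by field.
  have -> : - 4%:R * (g - v%:R - half) * (h + v%:R + half) / 4%:R
    = (h - half + 1 + v%:R) * (half - g + v%:R) by field.
  move: (h - half) (half - g) => b e; move: (jacobi e b v) => L /= ode.
  rewrite -[RHS](mulr0 (1 - 'X^2)) -[X in _ = _ * X]ode.
  rewrite -!mul_polyC !(polyCD, polyCN, polyCM, polyC_natr) polyC1 /=.
  by ring.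
- have := jacobi_ode (g - half) (h - half) v.
  rewrite derivB derivXn d1 deriv0.
  have -> : h - g = (h - half) - (g - half) by field.
  have -> : g + h + 1 = (g - half) + (h - half) + 2 by field.
  have -> : 4%:R * v%:R * (v%:R + g + h) / 4%:R
    = v%:R * (v%:R + (g - half) + (h - half) + 1) by field.
  move: (h - half) (g - half) => b a; move: (jacobi a b v) => L /= ode.
  rewrite -[RHS](mulr0 (1 - 'X^2)) -[X in _ = _ * X]ode.
  rewrite -!mul_polyC !(polyCD, polyCN, polyCM, polyC_natr) polyC1 /=.
  by ring.
Qed.
End SeedEigen.

(** * The polynomial identity *)

Section Gauge.
Variables (K : fieldType) (d : {additive K -> K}).
Hypothesis dM : forall x y, d (x * y) = d x * y + x * d y.
Local Notation td := (twisted_deriv d).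

Lemma deriv_div x y : y != 0 -> d (x / y) = (d x * y - x * d y) / y ^+ 2.
Proof. by move=> y0; rewrite dM derivV//; field. Qed.

Lemma deriv_nat n : d n%:R = 0.
Proof. by rewrite raddfMn/= (deriv1 dM) mul0rn. Qed.

Lemma deriv_exp_unit x n : x != 0 -> d (x ^+ n) = n%:R * (d x / x) * x ^+ n.
Proof.
move=> x0; elim: n => [|n IH]; first by rewrite expr0 (deriv1 dM) !mul0r.
by rewrite exprS dM IH -[n.+1%:R]natr1; field.
Qed.

Lemma td_gauge w theta rho u : d rho = theta * rho ->
  td w (rho * u) = rho * td (w + theta) u.
Proof. by move=> drho; rewrite !tdE dM drho; ring. Qed.

Variables (a b sa sb k1 k2 : K).
Hypotheses (a0 : a != 0) (b0 : b != 0).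
Hypotheses (da : d a = sa) (db : d b = sb).
Hypotheses (dsa : d sa = 0) (dsb : d sb = 0) (dk1 : d k1 = 0) (dk2 : d k2 = 0).

(** Turns the Crum operator into the numerator of [Htilde]. [L] is the log-derivative of the
    Wronskian, that is of [X * c ^- (p * q)] times the weights, and [sg] is that of
    [a ^+ p * b ^+ q]. [C1] is [c1] at the shifted parameters ([c1_shift]), and [C1 - dc] is the
    lowered one ([c1_shift_pred]). *)
Lemma gauge_identity (p q : nat) (P X : K)
    (c := a * b) (dc := sa * b + a * sb) (c1 := dc - k1 * b - k2 * a)
    (sg := p%:R * (sa / a) + q%:R * (sb / b))
    (L := d X / X - p%:R * q%:R * (dc / c) + (p%:R * (k1 / a) + q%:R * (k2 / b)))
    (C1 := c1 - (p%:R - q%:R) * (sa * b - sb * a)) :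
  X != 0 ->
  c * td (- sg) (td (- sg) (P / X)) + (c1 + (p + q)%:R * d c) * td (- sg) (P / X)
    + crum_potential d c c1 0 (p + q) L * (P / X)
  = (c * (X * d (d P)) + (C1 * X - 2 * c * d X) * d P
      + (c * d (d X) - (C1 - dc) * d X) * P) / X ^+ 2.
Proof.
move=> X0.
have dcE : d c = dc by rewrite dM da db.
have ddc : d dc = 2 * (sa * sb) by rewrite raddfD/= !dM da db dsa dsb; ring.
have c0 : c != 0 by rewrite mulf_neq0.
have dc1 : d c1 = 2 * (sa * sb) - k1 * sb - k2 * sa.
  by rewrite !raddfB/= ddc !dM dk1 dk2 da db; ring.
have dsg : d sg = - (p%:R * (sa / a) ^+ 2 + q%:R * (sb / b) ^+ 2).
  rewrite raddfD/= !dM !deriv_nat !derivV// da db dsa dsb; field.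
  by rewrite a0 b0.
have dL : d L = (d (d X) * X - d X ^+ 2) / X ^+ 2
   + p%:R * q%:R * ((sa / a) ^+ 2 + (sb / b) ^+ 2)
   - (p%:R * (k1 * sa / a ^+ 2) + q%:R * (k2 * sb / b ^+ 2)).
  have dn n x : d (n%:R * x) = n%:R * d x by rewrite dM deriv_nat mul0r add0r.
  rewrite /L raddfD raddfB/= raddfD/= !dn -natrM dn natrM !deriv_div//.
  rewrite dcE ddc da db dk1 dk2 /c /dc; field.
  by rewrite a0 b0 X0.
have dPX : d (P / X) = (d P * X - P * d X) / X ^+ 2 by exact: deriv_div.
have ddPX : d (d (P / X)) = (d (d P) * X - P * d (d X)) / X ^+ 2
    - 2 * d X * (d P * X - P * d X) / X ^+ 3.
  rewrite dPX deriv_div ?expf_neq0// deriv_exp_unit// raddfB/= !dM; field.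
  exact: X0.
have [u eu] : exists u, u = P / X by exists (P / X).
rewrite -!eu in dPX ddPX *.
have -> : crum_potential d c c1 0 (p + q) L =
    (p + q)%:R * d c1 + 'C(p + q, 2)%:R * (2 * (sa * sb)) + 2 * c * d L + dc * L.
  by rewrite /crum_potential add0r dcE ddc.
have bin : 'C(p + q, 2)%:R * 2 = (p + q)%:R * (p + q)%:R - (p + q)%:R :> K.
  have := bin_ffact (p + q) 2; rewrite mulnC => /(congr1 (fun n : nat => n%:R : K)).
  rewrite /= mulnC natrM => ->.
  by case: (p + q)%N => [|n]; rewrite ?ffact0n ?mul0r ?subr0//
    ffactnS ffactn1 natrM/= -natr1; ring.
have -> : 'C(p + q, 2)%:R * (2 * (sa * sb)) = ('C(p + q, 2)%:R * 2) * (sa * sb) by ring.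
rewrite bin !tdE raddfD/= !(dM _ u) raddfN/= dsg ddPX dPX eu dL dc1 dcE.
rewrite /C1 /L /sg /c1 /dc /c natrD.
move: (d (d P)) (d (d X)) (d P) (d X) => P2 X2 P1 X1.
move: (p%:R) (q%:R) => p' q'.
by field; rewrite a0 b0 X0.
Qed.
End Gauge.

(** * The identity in an abstract differential field containing the polynomials *)

Section FractionLevel.
Variables (R : realType) (K : fieldType) (d : {additive K -> K})
  (iota : {rmorphism {poly R} -> K}).
Hypothesis dM : forall x y, d (x * y) = d x * y + x * d y.
Hypothesis d_iota : forall p, d (iota p) = iota p^`().
Hypothesis iota_inj : injective iota.
Implicit Types (s : system R) (A D : index_pair).
Local Notation half := (2%:R^-1 : R).
Local Notation twist s := (kind_twist (factI s) (factII s) (expoI s) (expoII s)).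
Local Notation td := (twisted_deriv d).
Local Notation Wr := (twisted_wronskian d).
Local Notation cst x := (iota x%:P).

Lemma iota_neq0 p : p != 0 -> iota p != 0.
Proof. by apply: contra_neq => e; apply: iota_inj; rewrite e rmorph0. Qed.

Lemma d_cst x : d (cst x) = 0.
Proof. by rewrite d_iota derivC rmorph0. Qed.

Lemma factI_poly_neq0 s : factI s != 0.
Proof.
case: s => [g|g h] /=; first exact: oner_neq0.
by rewrite addrC -polyC1 -size_poly_eq0 size_XaddC.
Qed.

Lemma factII_poly_neq0 s : factII s != 0.
Proof.
case: s => [g|g h] /=; first by rewrite polyX_eq0.
by rewrite -opprB oppr_eq0 -polyC1 polyXsubC_eq0.
Qed.

(** In other words [c1 = c2' - c2 * (twist I + twist II)]. Hence the extra twist of [crum_remove_at]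
    cancels the weights of the two removed seeds, one of each type. *)
Lemma c1E s : c1 s = (c2 s)^`() - expoI s *: factII s - expoII s *: factI s.
Proof.
have d1 : (1 : {poly R})^`() = 0 by rewrite -polyC1 derivC.
case: s => [g|g h] /=; rewrite ?derivB ?derivX ?derivXn ?d1; do ?rewrite -mul_polyC.
  by rewrite (_ : g + half = 1 - (half - g)); [rewrite polyCB polyC1; ring|field].
have -> : h - g = - (half - h) - - (half - g) by ring.
have -> : g + h + 1 = 2 - (half - h) - (half - g) by field.
by rewrite /= !polyCB !polyCN; ring.
Qed.

Lemma c1_shift s (k : R) : c1 (shift_params s k (- k))
  = c1 s - k *: (slopeI s *: factII s - slopeII s *: factI s).
Proof.
case: s => [g|g h] /=; rewrite -!mul_polyC ?scale0r.
  by rewrite !polyCD; ring.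
by rewrite !(polyCD, polyCN); ring.
Qed.

Lemma c1_shift_pred s (k : R) : c1 (shift_params s (k - 1) (- k - 1))
  = c1 (shift_params s k (- k)) - (c2 s)^`().
Proof.
have d1 : (1 : {poly R})^`() = 0 by rewrite -polyC1 derivC.
case: s => [g|g h] /=; rewrite ?derivB ?derivX ?derivXn ?d1; do ?rewrite -mul_polyC.
  by rewrite !(polyCD, polyCN) polyC1; ring.
by rewrite !(polyCD, polyCN) polyC1; ring.
Qed.

Definition column_fraction s (q : column_kind * {poly R}) : K * K :=
  (iota (twist s q.1) / iota (c2 s), iota q.2).

Lemma iota_c2_neq0 s : iota (c2 s) != 0.
Proof. by rewrite iota_neq0// c2E mulf_neq0 ?factI_poly_neq0 ?factII_poly_neq0. Qed.

Lemma wronskian_column_fraction s l :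
  Wr (map (column_fraction s) l) = iota (jet_det s l) / iota (c2 s) ^+ 'C(size l, 2).
Proof.
exact: (twisted_wronskian_jet dM d_iota (iota_c2_neq0 s) (Untwisted, 0)).
Qed.
Lemma eigen_column s k v :
  eigen d (iota (c2 s)) (iota (c1 s)) 0 (cst (column_energy s k v / 4%:R))
    (column_fraction s (k, column_poly s k v)).
Proof.
split; last exact: d_cst.
have c0 := iota_c2_neq0 s.
pose J i := iota (jet (c2 s) (twist s k) (column_poly s k v) i).
have J1 : td (iota (twist s k) / iota (c2 s)) (iota (column_poly s k v)) = J 1%N / iota (c2 s).
  exact: (iter_twisted_deriv_jet dM d_iota c0 _ _ 1).
have J2 : td (iota (twist s k) / iota (c2 s)) (J 1%N / iota (c2 s)) = J 2%N / iota (c2 s) ^+ 2.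
  by rewrite -J1; exact: (iter_twisted_deriv_jet dM d_iota c0 _ _ 2).
have gen (j2 b j1 E u : {poly R}) : j2 + b * j1 + E * (c2 s * u) = 0 ->
    iota j2 + iota b * iota j1 + iota E * (iota (c2 s) * iota u) = 0.
  by move/(congr1 iota); rewrite !rmorphD !rmorphM rmorph0.
have := gen _ _ _ _ _ (jet_eigen s k v).
rewrite -/(J 1%N) -/(J 2%N) => e.
change (iota (c2 s) * td (iota (twist s k) / iota (c2 s))
    (td (iota (twist s k) / iota (c2 s)) (iota (column_poly s k v)))
  + iota (c1 s) * td (iota (twist s k) / iota (c2 s)) (iota (column_poly s k v))
  + 0 * iota (column_poly s k v)
  + cst (column_energy s k v / 4%:R) * iota (column_poly s k v) = 0).
rewrite J1 J2.
apply: (mulfI c0); rewrite mulr0 -[RHS]e {e}.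
move: (J 1%N) (J 2%N) (iota (c1 s)) (cst _) (iota (column_poly s k v)) => j1 j2 b E u.
by field.
Qed.

Lemma normal_cst_neq0 s : cst (normal s) != 0.
Proof. by rewrite iota_neq0// polyC_eq0 normal_neq0. Qed.

Lemma Xi_fraction s A (p := size (idxI A)) (q := size (idxII A)) :
  Wr (map (column_fraction s) (columns s A))
  = iota (Xi s A) * (cst (normal s) ^+ (p * q + p * q) / iota (c2 s) ^+ (p * q)).
Proof.
rewrite wronskian_column_fraction size_columns.
have c0 m : iota (c2 s) ^+ m != 0 by rewrite expf_neq0// iota_c2_neq0.
have := congr1 iota (Xi_jet_det s A).
rewrite -mul_polyC polyC_exp !rmorphM !rmorphXn/= -/p -/q.
move: (c0 (p * q)%N) (c0 'C(p + q, 2)); move: (_ ^+ (p * q)) (_ ^+ 'C(_, _)) => x y x0 y0.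
move: (iota (jet_det _ _)) (iota (Xi s A)) (cst _ ^+ _) => J X N e.
apply: (mulIf (mulf_neq0 x0 y0)).
transitivity (J * x); first by field.
by rewrite e; field.
Qed.

Lemma P_fraction s A n (p := size (idxI A)) (q := size (idxII A)) :
  Wr (map (column_fraction s) (rcons (columns s A) (Untwisted, base_poly s n)))
  = iota (P_poly s A n) * (cst (normal s) ^+ (q.+1 * p + p.+1 * q)
      / (iota (factI s) ^+ (q.+1 * p) * iota (factII s) ^+ (p.+1 * q))).
Proof.
rewrite wronskian_column_fraction size_rcons size_columns.
have c0 m : iota (c2 s) ^+ m != 0 by rewrite expf_neq0// iota_c2_neq0.
have a0 m : iota (factI s) ^+ m != 0 by rewrite expf_neq0// iota_neq0// factI_poly_neq0.
have b0 m : iota (factII s) ^+ m != 0 by rewrite expf_neq0// iota_neq0// factII_poly_neq0.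
have := congr1 iota (P_jet_det s A n).1.
rewrite -mul_polyC polyC_exp !rmorphM !rmorphXn/= -/p -/q.
move: (c0 'C((p + q).+1, 2)) (a0 (q.+1 * p)%N) (b0 (p.+1 * q)%N).
move: (iota (c2 s) ^+ _) (iota (factI s) ^+ _) (iota (factII s) ^+ _) => y a b y0 a0' b0'.
move: (iota (jet_det _ _)) (iota (P_poly s A n)) (cst _ ^+ _) => J X N e.
apply: (mulIf (mulf_neq0 (mulf_neq0 a0' b0') y0)).
transitivity (J * (a * b)); first by field.
by rewrite e; field; rewrite a0' b0'.
Qed.

Lemma total_twist_columns s A (p := size (idxI A)) (q := size (idxII A)) :
  total_twist (map (column_fraction s) (columns s A))
  = p%:R * (cst (expoI s) / iota (factI s)) + q%:R * (cst (expoII s) / iota (factII s)).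
Proof.
have a0 : iota (factI s) != 0 by rewrite iota_neq0// factI_poly_neq0.
have b0 : iota (factII s) != 0 by rewrite iota_neq0// factII_poly_neq0.
rewrite /total_twist big_map /columns big_cat !big_map/= !big_const_seq.
rewrite !iter_addr_0 !count_predT -/p -/q -[X in X + _]mulr_natl -[X in _ + X]mulr_natl -!mul_polyC.
rewrite !rmorphM c2E rmorphM/=.
by move: (p%:R) (q%:R) => p' q'; field; rewrite a0 b0.
Qed.

Lemma log_deriv_columns s A (p := size (idxI A)) (q := size (idxII A)) :
  Xi s A != 0 ->
  log_deriv d (map (column_fraction s) (columns s A))
  = d (iota (Xi s A)) / iota (Xi s A) - p%:R * q%:R * (d (iota (c2 s)) / iota (c2 s))
    + (p%:R * (cst (expoI s) / iota (factI s)) + q%:R * (cst (expoII s) / iota (factII s))).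
Proof.
move=> X0; have c0 := iota_c2_neq0 s; have {}X0 := iota_neq0 X0.
rewrite /log_deriv total_twist_columns -/p -/q Xi_fraction -/p -/q.
set w := _ + _; set X := iota (Xi s A).
have N0 := expf_neq0 (p * q + p * q) (normal_cst_neq0 s).
have cm0 := expf_neq0 (p * q) c0.
rewrite tdE dM (deriv_div dM _ cm0) (deriv_exp_unit dM _ c0).
rewrite -rmorphXn -polyC_exp d_cst polyC_exp rmorphXn natrM.
move: (d X) (d (iota (c2 s))) (p%:R) (q%:R) w => X1 c' p' q' w.
move: (iota (c2 s) ^+ _) (cst _ ^+ _) cm0 N0 => cm N cm0 N0.
by field; rewrite c0 cm0 N0 X0.
Qed.
(** This is [- X / 4] times [Htilde] applied to [P], with [X] in the role of [Xi]: the denominators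
    are cleared. *)
Definition operator_num s (k : R) (X P : {poly R}) : {poly R} :=
  c2 s * (X * P^`(2))
  + (c1 (shift_params s k (- k)) * X - 2%:R * c2 s * X^`()) * P^`()
  + (c2 s * X^`(2) - c1 (shift_params s (k - 1) (- k - 1)) * X^`()) * P.

Lemma operator_fraction s (p q : nat) (X P : {poly R})
    (sg := p%:R * (cst (slopeI s) / iota (factI s))
      + q%:R * (cst (slopeII s) / iota (factII s)))
    (L := d (iota X) / iota X - p%:R * q%:R * (d (iota (c2 s)) / iota (c2 s))
    + (p%:R * (cst (expoI s) / iota (factI s)) + q%:R * (cst (expoII s) / iota (factII s)))) :
  X != 0 ->
  iota (c2 s) * td (- sg) (td (- sg) (iota P / iota X))
    + (iota (c1 s) + (p + q)%:R * d (iota (c2 s))) * td (- sg) (iota P / iota X)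
    + crum_potential d (iota (c2 s)) (iota (c1 s)) 0 (p + q) L * (iota P / iota X)
  = iota (operator_num s (p%:R - q%:R) X P) / iota X ^+ 2.
Proof.
move=> X0.
have a0 := iota_neq0 (factI_poly_neq0 s); have b0 := iota_neq0 (factII_poly_neq0 s).
have da : d (iota (factI s)) = cst (slopeI s) by rewrite d_iota deriv_factI.
have db : d (iota (factII s)) = cst (slopeII s) by rewrite d_iota deriv_factII.
have dc : d (iota (c2 s)) = cst (slopeI s) * iota (factII s) + iota (factI s) * cst (slopeII s).
  by rewrite c2E rmorphM dM da db.
have ec1 : iota (c1 s) = d (iota (c2 s)) - cst (expoI s) * iota (factII s)
    - cst (expoII s) * iota (factI s).
  by rewrite c1E !rmorphB -!mul_polyC !rmorphM d_iota.
have := gauge_identity dM a0 b0 da db (d_cst _) (d_cst _) (d_cst (expoI s)) (d_cst (expoII s))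
  p q (iota P) (iota_neq0 X0).
rewrite -dc -rmorphM -c2E -ec1 -/sg -/L => ->.
congr (_ / _); rewrite /operator_num c1_shift_pred c1_shift.
rewrite -!mul_polyC polyCB !polyC_natr !d_iota.
have d2 (r : {poly R}) : r^`(2) = r^`()^`() by [].
by rewrite !d2 !(rmorphD, rmorphB, rmorphM, rmorph_nat)/=; ring.
Qed.

Lemma td2_gauge (w theta sg rho u : K) : d rho = theta * rho -> w + theta = - sg ->
  (td w (rho * u) = rho * td (- sg) u) *
  (td w (td w (rho * u)) = rho * td (- sg) (td (- sg) u)).
Proof. by move=> drho <-; rewrite !(td_gauge dM w _ drho). Qed.
Lemma deriv_factor_pow s (m n : nat) (x : K) : d x = 0 ->
  d (x * (iota (factI s) ^+ m * iota (factII s) ^+ n))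
  = (m%:R * (cst (slopeI s) / iota (factI s)) + n%:R * (cst (slopeII s) / iota (factII s)))
    * (x * (iota (factI s) ^+ m * iota (factII s) ^+ n)).
Proof.
move=> dx; have a0 := iota_neq0 (factI_poly_neq0 s); have b0 := iota_neq0 (factII_poly_neq0 s).
rewrite !dM dx (deriv_exp_unit dM _ a0) (deriv_exp_unit dM _ b0) !d_iota
  deriv_factI deriv_factII.
by ring.
Qed.

Lemma deriv_factor_powV s (m n : nat) (x : K) : d x = 0 ->
  d (x / (iota (factI s) ^+ m * iota (factII s) ^+ n))
  = - (m%:R * (cst (slopeI s) / iota (factI s)) + n%:R * (cst (slopeII s) / iota (factII s)))
    * (x / (iota (factI s) ^+ m * iota (factII s) ^+ n)).
Proof.
move=> dx; have a0 := iota_neq0 (factI_poly_neq0 s); have b0 := iota_neq0 (factII_poly_neq0 s).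
have am := expf_neq0 m a0; have bn := expf_neq0 n b0.
rewrite (deriv_div dM) ?mulf_neq0// dM dx.
rewrite (deriv_exp_unit dM _ a0) (deriv_exp_unit dM _ b0) !d_iota
  deriv_factI deriv_factII.
move: (_ ^+ m) (_ ^+ n) am bn => A B A0 B0.
by field; rewrite a0 b0 A0 B0.
Qed.

Lemma d_normal_pow s m : d (cst (normal s) ^+ m) = 0.
Proof. by rewrite -rmorphXn -polyC_exp d_cst. Qed.

Definition is_column s (q : column_kind * {poly R}) : Prop :=
  exists k v, q = (k, column_poly s k v).

Lemma eigen_columns s l : (forall q, q \in l -> is_column s q) ->
  forall f, f \in map (column_fraction s) l ->
    exists lam, eigen d (iota (c2 s)) (iota (c1 s)) 0 lam f.
Proof.
move=> ls _ /mapP[q /ls[k [v ->]] ->].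
by exists (cst (column_energy s k v / 4%:R)); apply: eigen_column.
Qed.

Lemma eigen_base s n : eigen d (iota (c2 s)) (iota (c1 s)) 0 (cst (energy s n / 4%:R))
    (column_fraction s (Untwisted, base_poly s n)).
Proof. exact: (eigen_column s Untwisted n). Qed.

Lemma combine_replace (c b cr T1 T2 lf lg lh rho Nx P X Q Y : K) :
  X != 0 -> rho != 0 -> Nx != 0 ->
  c * (rho * T2) + b * (rho * T1) + cr * (rho * (P / X)) + (lf + lg - lh) * (rho * (P / X))
    = 2 * (lg - lh) * (Q * (rho * Nx) * (Y * Nx)) / (X * Nx) ^+ 2 ->
  (c * T2 + b * T1 + cr * (P / X)) * X ^+ 2 + (lf + lg - lh) * (X * P)
    = 2 * (lg - lh) * (Q * Y).
Proof.
move=> X0 rho0 N0 e; apply: (mulfI rho0).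
transitivity ((c * (rho * T2) + b * (rho * T1) + cr * (rho * (P / X))
  + (lf + lg - lh) * (rho * (P / X))) * X ^+ 2); first by field.
by rewrite e; field; rewrite X0 N0.
Qed.

Lemma replace_identity s D D' n k l1 l2 v eps
    (p := size (idxI D)) (q := size (idxII D)) :
  columns s D = l1 ++ (k, column_poly s k v) :: l2 ->
  columns s D' = l1 ++ (k, column_poly s k eps) :: l2 ->
  size (idxI D') = p -> size (idxII D') = q ->
  (forall x, x \in l1 ++ l2 -> is_column s x) -> Xi s D != 0 ->
  operator_num s (p%:R - q%:R) (Xi s D) (P_poly s D' n)
    + ((column_energy s k v + column_energy s k eps - energy s n) / 4%:R)%:P
      * (Xi s D * P_poly s D' n)
  = (2%:R * (column_energy s k eps - energy s n) / 4%:R)%:P * (P_poly s D n * Xi s D').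
Proof.
move=> eD eD' sp sq l12 X0.
have c0 := iota_c2_neq0 s; have N0 := normal_cst_neq0 s.
have a0 := iota_neq0 (factI_poly_neq0 s); have b0 := iota_neq0 (factII_poly_neq0 s).
have XK := iota_neq0 X0.
set f := column_fraction s (k, column_poly s k v).
set g := column_fraction s (k, column_poly s k eps).
set h := column_fraction s (Untwisted, base_poly s n).
set L1 := map (column_fraction s) l1; set L2 := map (column_fraction s) l2.
pose Nx := cst (normal s) ^+ (p * q + p * q) / iota (c2 s) ^+ (p * q).
pose Np := cst (normal s) ^+ (q.+1 * p + p.+1 * q)
   / (iota (factI s) ^+ (q.+1 * p) * iota (factII s) ^+ (p.+1 * q)).
have wD : Wr (L1 ++ f :: L2) = iota (Xi s D) * Nx.
  by have := Xi_fraction s D; rewrite eD map_cat.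
have wD' : Wr (L1 ++ g :: L2) = iota (Xi s D') * Nx.
  by have := Xi_fraction s D'; rewrite eD' map_cat sp sq.
have pD : Wr (L1 ++ f :: L2 ++ [:: h]) = iota (P_poly s D n) * Np.
  by have := P_fraction s D n; rewrite eD -cats1 -catA map_cat/= map_cat.
have pD' : Wr (L1 ++ g :: L2 ++ [:: h]) = iota (P_poly s D' n) * Np.
  by have := P_fraction s D' n; rewrite eD' -cats1 -catA map_cat/= map_cat sp sq.
have Nx0 : Nx != 0 by rewrite mulf_neq0 ?invr_eq0 ?expf_neq0.
have W0 : Wr (L1 ++ f :: L2) != 0 by rewrite wD mulf_neq0.
have sz : (size (L1 ++ L2)).+1 = (p + q)%N.
  by have := size_columns s D; rewrite eD -/p -/q => <-; rewrite !size_cat !size_map/= addnS.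
have eL := log_deriv_columns X0; rewrite eD map_cat/= -/f -/L1 -/L2 in eL.
have l12K : forall x, x \in L1 ++ L2 ->
    exists lam, eigen d (iota (c2 s)) (iota (c1 s)) 0 lam x.
  by rewrite -map_cat; apply: eigen_columns.
have := crum_replace_at dM c0 W0 l12K (eigen_column s k v) (eigen_column s k eps)
  (eigen_base s n).
rewrite sz eL -/f -/g -/h.
(* [rho = Np / Nx] is the ratio of the normalisations of [P_poly] and [Xi]. Its log-derivative is
   [- sg], the twist that [operator_fraction] expects. *)
pose rho := cst (normal s) ^+ (p + q) / (iota (factI s) ^+ p * iota (factII s) ^+ q).
have rho0 : rho != 0 by rewrite !mulf_neq0 ?invr_eq0 ?mulf_neq0 ?expf_neq0.
have eN : Np = rho * Nx.
  rewrite /Np /Nx /rho !mulSn [(q * p)%N]mulnC.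
  rewrite (_ : (p + p * q + (q + p * q) = (p + q) + (p * q + p * q))%N); last by lia.
  rewrite !(exprD _ (p + q)) !(exprD _ p (p * q)) !(exprD _ q (p * q)) c2E rmorphM exprMn.
  have := expf_neq0 p a0; have := expf_neq0 q b0.
  have := expf_neq0 (p * q) a0; have := expf_neq0 (p * q) b0.
  move: (_ ^+ p) (_ ^+ q) (_ ^+ (p * q)) (_ ^+ (p * q)) => A B C E h1 h2 h3 h4.
  by field; rewrite h1 h2 h3 h4.
have drho := deriv_factor_powV s p q (d_normal_pow s (p + q)); rewrite -/rho in drho.
(* The two exchanged seeds have the same weight and [h] has none, so only the log-derivative of
   [rho] is left. *)
have ew : g.1 + h.1 - f.1 + - (p%:R * (cst (slopeI s) / iota (factI s))
    + q%:R * (cst (slopeII s) / iota (factII s)))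
  = - (p%:R * (cst (slopeI s) / iota (factI s)) + q%:R * (cst (slopeII s) / iota (factII s))).
  by rewrite /= rmorph0 mul0r addr0 subrr add0r.
have ey : Wr (L1 ++ g :: L2 ++ [:: h]) / Wr (L1 ++ f :: L2)
    = rho * (iota (P_poly s D' n) / iota (Xi s D)).
  by rewrite pD' wD eN; field; rewrite XK Nx0.
rewrite ey !(td2_gauge _ drho ew) pD wD' wD eN.
have := operator_fraction s p q (P_poly s D' n) X0.
set T1 := td _ (iota _ / _); set T2 := td _ T1; set cr := crum_potential _ _ _ _ _ _.
move=> eop e; apply: iota_inj.
have {}eop : iota (operator_num s (p%:R - q%:R) (Xi s D) (P_poly s D' n))
   = (iota (c2 s) * T2 + (iota (c1 s) + (p + q)%:R * d (iota (c2 s))) * T1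
      + cr * (iota (P_poly s D' n) / iota (Xi s D))) * iota (Xi s D) ^+ 2.
  by rewrite eop divfK// expf_neq0.
rewrite (rmorphD iota (operator_num _ _ _ _)) eop !(rmorphM iota) /=.
have -> : cst ((column_energy s k v + column_energy s k eps - energy s n) / 4%:R)
  = cst (column_energy s k v / 4%:R) + cst (column_energy s k eps / 4%:R)
    - cst (energy s n / 4%:R).
  by rewrite -rmorphD -rmorphB -polyCD -polyCB -mulrDl -mulrBl.
have -> : cst (2%:R * (column_energy s k eps - energy s n) / 4%:R)
  = 2%:R * (cst (column_energy s k eps / 4%:R) - cst (energy s n / 4%:R)).
  by rewrite -mulrA mulrBl polyCM polyC_natr rmorphM rmorph_nat polyCB rmorphB.
apply: combine_replace XK rho0 Nx0 e.
Qed.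

Lemma combine_remove (c b cr T1 T2 lf lg lh rho Np Nx Ny N P X Q Y : K) :
  X != 0 -> rho != 0 -> Nx != 0 -> c * (Np * Ny) = N * (rho * Nx ^+ 2) ->
  c * (rho * T2) + b * (rho * T1) + cr * (rho * (P / X)) + (lf + lg - lh) * (rho * (P / X))
    = 2 * c * (Q * Np * (Y * Ny)) / (X * Nx) ^+ 2 ->
  (c * T2 + b * T1 + cr * (P / X)) * X ^+ 2 + (lf + lg - lh) * (X * P)
    = 2 * N * (Q * Y).
Proof.
move=> X0 rho0 N0 eN e; apply: (mulfI rho0).
transitivity ((c * (rho * T2) + b * (rho * T1) + cr * (rho * (P / X))
  + (lf + lg - lh) * (rho * (P / X))) * X ^+ 2); first by field.
rewrite e; transitivity (2 * (c * (Np * Ny)) * (Q * Y) / Nx ^+ 2).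
  by field; rewrite X0 N0.
by rewrite eN; field.
Qed.

Lemma weight_ratio (n1 n3 z s t a1 b1 u w : K) :
  z != 0 -> s != 0 -> t != 0 -> a1 != 0 -> b1 != 0 ->
  n1 * z = n3 -> s * a1 = u -> t * b1 = w ->
  n1 / (a1 * b1) = z^-1 * (s * t) * (n3 / (u * w)).
Proof.
by move=> z0 s0 t0 a0 b0 <- <- <-; field; rewrite z0 s0 t0 a0 b0.
Qed.

Lemma weight_ratio2 (a b N n1 n2 n3 z s t a1 b1 a2 b2 u w : K) :
  z != 0 -> u != 0 -> w != 0 -> a1 != 0 -> b1 != 0 -> a2 != 0 -> b2 != 0 ->
  n1 * n2 * z = N * n3 ^+ 2 -> a * u ^+ 2 = s * (a1 * a2) -> b * w ^+ 2 = t * (b1 * b2) ->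
  a * b * (n1 / (a1 * b1) * (n2 / (a2 * b2))) = N * (z^-1 * (s * t) * (n3 / (u * w)) ^+ 2).
Proof.
move=> z0 u0 w0 a10 b10 a20 b20 eN ea eb.
transitivity (n1 * n2 * z / z * (a / (a1 * a2)) * (b / (b1 * b2))).
  by field; rewrite z0 a10 b10 a20 b20.
have -> : a / (a1 * a2) = s / u ^+ 2.
  by apply/eqP; rewrite eqr_div ?mulf_neq0 ?expf_neq0// ea.
have -> : b / (b1 * b2) = t / w ^+ 2.
  by apply/eqP; rewrite eqr_div ?mulf_neq0 ?expf_neq0// eb.
by rewrite eN; field; rewrite z0 u0 w0.
Qed.

(** Here [D] and its target have different numbers of seeds, so the normalisations do not cancel
    completely: [normal s ^+ 2] survives (see [eM]) and makes the coefficient depend on the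
    system. *)
Lemma remove_identity s D D' n l1 l2 l3 v1 v2
    (p := (size (idxI D'))) (q := (size (idxII D'))) :
  columns s D = l1 ++ (TypeI, column_poly s TypeI v1) :: l2
                  ++ (TypeII, column_poly s TypeII v2) :: l3 ->
  columns s D' = l1 ++ l2 ++ l3 ->
  size (idxI D) = p.+1 -> size (idxII D) = q.+1 ->
  (forall x, x \in l1 ++ l2 ++ l3 -> is_column s x) -> Xi s D != 0 ->
  operator_num s (p.+1%:R - q.+1%:R) (Xi s D) (P_poly s D' n)
    + ((column_energy s TypeI v1 + column_energy s TypeII v2 - energy s n) / 4%:R)%:P
      * (Xi s D * P_poly s D' n)
  = (2%:R * normal s ^+ 2)%:P * (P_poly s D n * Xi s D').
Proof.
move=> eD eD' sp sq l123 X0.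
have c0 := iota_c2_neq0 s; have N0 := normal_cst_neq0 s.
have a0 := iota_neq0 (factI_poly_neq0 s); have b0 := iota_neq0 (factII_poly_neq0 s).
have XK := iota_neq0 X0.
set f1 := column_fraction s (TypeI, column_poly s TypeI v1).
set f2 := column_fraction s (TypeII, column_poly s TypeII v2).
set h := column_fraction s (Untwisted, base_poly s n).
set L1 := map (column_fraction s) l1; set L2 := map (column_fraction s) l2.
set L3 := map (column_fraction s) l3.
pose Nx := cst (normal s) ^+ (p.+1 * q.+1 + p.+1 * q.+1) / iota (c2 s) ^+ (p.+1 * q.+1).
pose Np := cst (normal s) ^+ (q.+2 * p.+1 + p.+2 * q.+1)
   / (iota (factI s) ^+ (q.+2 * p.+1) * iota (factII s) ^+ (p.+2 * q.+1)).
pose Ny := cst (normal s) ^+ (p * q + p * q) / iota (c2 s) ^+ (p * q).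
pose Nq := cst (normal s) ^+ (q.+1 * p + p.+1 * q)
   / (iota (factI s) ^+ (q.+1 * p) * iota (factII s) ^+ (p.+1 * q)).
have wD : Wr (L1 ++ f1 :: L2 ++ f2 :: L3) = iota (Xi s D) * Nx.
  by have := Xi_fraction s D; rewrite eD map_cat/= map_cat sp sq.
have wD' : Wr (L1 ++ L2 ++ L3) = iota (Xi s D') * Ny.
  by have := Xi_fraction s D'; rewrite eD' !map_cat.
have pD : Wr ((L1 ++ f1 :: L2 ++ f2 :: L3) ++ [:: h]) = iota (P_poly s D n) * Np.
  by have := P_fraction s D n; rewrite eD -cats1 !map_cat/= map_cat sp sq.
have pD' : Wr ((L1 ++ L2 ++ L3) ++ [:: h]) = iota (P_poly s D' n) * Nq.
  by have := P_fraction s D' n; rewrite eD' -cats1 !map_cat.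
have Nx0 : Nx != 0 by rewrite mulf_neq0 ?invr_eq0 ?expf_neq0.
have W0 : Wr (L1 ++ f1 :: L2 ++ f2 :: L3) != 0 by rewrite wD mulf_neq0.
have sz : size (L1 ++ L2 ++ L3) = (p + q)%N.
  by have := size_columns s D'; rewrite eD' -/p -/q => <-; rewrite !size_cat !size_map.
have eL := log_deriv_columns X0; rewrite eD map_cat/= map_cat/= sp sq in eL.
have lK : forall x, x \in L1 ++ L2 ++ L3 ->
    exists lam, eigen d (iota (c2 s)) (iota (c1 s)) 0 lam x.
  by rewrite -!map_cat; apply: eigen_columns.
have := crum_remove_at dM c0 W0 lK (eigen_column s TypeI v1) (eigen_column s TypeII v2)
  (eigen_base s n).
rewrite sz eL -/f1 -/f2 -/h.
(* Again [P_poly] of the target over [Xi] of [D]; losing one seed of each type makes the powers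
   positive and crosses them, [q.+1] for [factI] and [p.+1] for [factII]. *)
pose rho := (cst (normal s) ^+ (p.+1 + q.+1))^-1
   * (iota (factI s) ^+ q.+1 * iota (factII s) ^+ p.+1).
have rho0 : rho != 0 by rewrite !mulf_neq0 ?invr_eq0 ?mulf_neq0 ?expf_neq0.
have am m := expf_neq0 m a0; have bm m := expf_neq0 m b0; have Nm m := expf_neq0 m N0.
have ec m : iota (c2 s) ^+ m = iota (factI s) ^+ m * iota (factII s) ^+ m.
  by rewrite c2E rmorphM exprMn.
have eN : Nq = rho * Nx.
  rewrite /Nq /Nx /rho ec; apply: weight_ratio => //; rewrite -exprD; congr (_ ^+ _); lia.
(* The powers of the factors of [c2] match once the [c] from [2 * c] in [crum_remove_at] is counted.
   The powers of [normal s] are [4pq + 3p + 3q + 4] on the left and two less in [rho * Nx ^+ 2]. *)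
have eM : iota (c2 s) * (Np * Ny) = cst (normal s) ^+ 2 * (rho * Nx ^+ 2).
  rewrite /Np /Ny /Nx /rho !ec -[iota (c2 s)]expr1 ec !expr1.
  by apply: weight_ratio2 => //; rewrite -!exprM -?exprS -!exprD -?exprS -?exprD;
     congr (_ ^+ _); lia.
have dN : d (cst (normal s) ^+ (p.+1 + q.+1))^-1 = 0.
  by rewrite (derivV dM) ?d_normal_pow ?oppr0 ?mul0r.
have drho := deriv_factor_pow s q.+1 p.+1 dN; rewrite -/rho in drho.
(* By [c1E] the weights drop out and [- (p + q + 2) * c2' / c2] remains; adding [q + 1] and [p + 1]
   log-derivatives of the two factors leaves [p + 1] and [q + 1]. *)
have ew : h.1 - f1.1 - f2.1 - (iota (c1 s) + (p + q).+1%:R * d (iota (c2 s))) / iota (c2 s)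
   + (q.+1%:R * (cst (slopeI s) / iota (factI s))
      + p.+1%:R * (cst (slopeII s) / iota (factII s)))
  = - (p.+1%:R * (cst (slopeI s) / iota (factI s))
    + q.+1%:R * (cst (slopeII s) / iota (factII s))).
  have dc : d (iota (c2 s)) = cst (slopeI s) * iota (factII s)
      + iota (factI s) * cst (slopeII s).
    by rewrite c2E rmorphM dM !d_iota deriv_factI deriv_factII.
  rewrite /= c1E !rmorphB -!mul_polyC !(rmorphM iota) -d_iota dc c2E rmorph0 rmorphM.
  rewrite -[(p + q).+1%:R]natr1 natrD -[p.+1%:R]natr1 -[q.+1%:R]natr1.
  by field; rewrite a0 b0.
have ey : Wr ((L1 ++ L2 ++ L3) ++ [:: h]) / Wr (L1 ++ f1 :: L2 ++ f2 :: L3)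
    = rho * (iota (P_poly s D' n) / iota (Xi s D)).
  by rewrite pD' wD eN; field; rewrite XK Nx0.
rewrite ey !(td2_gauge _ drho ew) pD wD' wD.
have := operator_fraction s p.+1 q.+1 (P_poly s D' n) X0.
rewrite addSn addnS.
set T1 := td _ (iota _ / _); set T2 := td _ T1; set cr := crum_potential _ _ _ _ _ _.
move=> eop e; apply: iota_inj.
have {}eop : iota (operator_num s (p.+1%:R - q.+1%:R) (Xi s D) (P_poly s D' n))
   = (iota (c2 s) * T2 + (iota (c1 s) + (p + q).+2%:R * d (iota (c2 s))) * T1
      + cr * (iota (P_poly s D' n) / iota (Xi s D))) * iota (Xi s D) ^+ 2.
  by rewrite eop divfK// expf_neq0.
rewrite (rmorphD iota (operator_num _ _ _ _)) eop !(rmorphM iota) /=.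
have -> : cst ((column_energy s TypeI v1 + column_energy s TypeII v2 - energy s n) / 4%:R)
  = cst (column_energy s TypeI v1 / 4%:R) + cst (column_energy s TypeII v2 / 4%:R)
    - cst (energy s n / 4%:R).
  by rewrite -rmorphD -rmorphB -polyCD -polyCB -mulrDl -mulrBl.
have -> : cst (2%:R * normal s ^+ 2) = 2%:R * cst (normal s) ^+ 2.
  by rewrite polyCM polyC_natr rmorphM rmorph_nat polyC_exp rmorphXn.
exact: combine_remove XK rho0 Nx0 eM e.
Qed.
End FractionLevel.

(** * The three kinds of moves and the degrees of their targets *)

Section PolynomialIdentity.
Variable R : realType.
Implicit Types (s : system R) (A D : index_pair).

Lemma columns_is_column s A x : x \in columns s A -> is_column s x.
Proof.
rewrite mem_cat => /orP[] /mapP[v _ ->].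
  by exists TypeI, v.
by exists TypeII, v.
Qed.

Lemma tofrac_inj : injective (@FracField.tofrac {poly R}).
Proof. by move=> p q /eqP; rewrite tofrac_eq => /eqP. Qed.

Lemma take_nth_drop (l : seq nat) j : (j < size l)%N ->
  l = take j l ++ nth 0%N l j :: drop j.+1 l.
Proof. by move=> jl; rewrite -drop_nth// cat_take_drop. Qed.

Lemma size_target s D m : in_EP D m ->
  match m with
  | RemoveIII _ _ => (size (idxI D) = (size (idxI (target D m))).+1) *
                     (size (idxII D) = (size (idxII (target D m))).+1)
  | _ => (size (idxI (target D m)) = size (idxI D)) *
         (size (idxII (target D m)) = size (idxII D))
  end.
Proof.
case: m => [j e|j e|j k] /=.
- by case/and3P=> jD _ _; rewrite size_set_nth (maxn_idPr jD).
- by case/and3P=> jD _ _; rewrite size_set_nth (maxn_idPr jD).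
- case/andP => jD kD; rewrite /delete_at !size_cat !size_take !size_drop jD kD.
  by split; lia.
Qed.

Lemma EP_identity s D n m (k := (size (idxI D))%:R - (size (idxII D))%:R : R) :
  in_EP D m -> Xi s D != 0 ->
  operator_num s k (Xi s D) (P_poly s (target D m) n)
    + (energyEP s D n m / 4%:R)%:P * (Xi s D * P_poly s (target D m) n)
  = (- (coefEP s n m / 4%:R))%:P * (P_poly s D n * Xi s (target D m)).
Proof.
move=> mD X0; have := size_target s mD; case: m mD => [j e|j e|i j] mD [sp sq].
- have /and3P[jD _ _] := mD.
  have eI := take_nth_drop jD.
  pose l1 := [seq (TypeI, seed_polyI s v) | v <- take j (idxI D)].
  pose l2 := [seq (TypeI, seed_polyI s v) | v <- drop j.+1 (idxI D)]
    ++ [seq (TypeII, seed_polyII s v) | v <- idxII D].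
  have eD : columns s D = l1 ++ (TypeI, column_poly s TypeI (nth 0%N (idxI D) j)) :: l2.
    by rewrite /columns {1}eI map_cat/= -catA.
  have eD' : columns s (target D (ReplaceI j e)) = l1 ++ (TypeI, column_poly s TypeI e) :: l2.
    by rewrite /columns/= set_nthE jD map_cat/= -catA.
  have l12 x : x \in l1 ++ l2 -> is_column s x.
    move=> xl; apply: (@columns_is_column s D); rewrite eD.
    by move: xl; rewrite (mem_cat x l1 l2) (mem_cat x l1) inE => /orP[->//|->]; rewrite !orbT.
  have := replace_identity (@frac_derivM _) (@frac_deriv_tofrac _) tofrac_inj
    n eD eD' sp sq l12 X0.
  by rewrite /k => ->; congr (_%:P * _); rewrite /=; field.
- have /and3P[jD _ _] := mD.
  have eI := take_nth_drop jD.
  pose l1 := [seq (TypeI, seed_polyI s v) | v <- idxI D]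
    ++ [seq (TypeII, seed_polyII s v) | v <- take j (idxII D)].
  pose l2 := [seq (TypeII, seed_polyII s v) | v <- drop j.+1 (idxII D)].
  have eD : columns s D = l1 ++ (TypeII, column_poly s TypeII (nth 0%N (idxII D) j)) :: l2.
    by rewrite /columns {1}eI map_cat/= catA.
  have eD' : columns s (target D (ReplaceII j e))
      = l1 ++ (TypeII, column_poly s TypeII e) :: l2.
    by rewrite /columns/= set_nthE jD map_cat/= catA.
  have l12 x : x \in l1 ++ l2 -> is_column s x.
    move=> xl; apply: (@columns_is_column s D); rewrite eD.
    by move: xl; rewrite (mem_cat x l1 l2) (mem_cat x l1) inE => /orP[->//|->]; rewrite !orbT.
  have := replace_identity (@frac_derivM _) (@frac_deriv_tofrac _) tofrac_inj
    n eD eD' sp sq l12 X0.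
  by rewrite /k => ->; congr (_%:P * _); rewrite /=; field.
- have /andP[iD jD] := mD.
  have eI := take_nth_drop iD; have eII := take_nth_drop jD.
  pose l1 := [seq (TypeI, seed_polyI s v) | v <- take i (idxI D)].
  pose l2 := [seq (TypeI, seed_polyI s v) | v <- drop i.+1 (idxI D)]
    ++ [seq (TypeII, seed_polyII s v) | v <- take j (idxII D)].
  pose l3 := [seq (TypeII, seed_polyII s v) | v <- drop j.+1 (idxII D)].
  have eD : columns s D = l1 ++ (TypeI, column_poly s TypeI (nth 0%N (idxI D) i)) :: l2
     ++ (TypeII, column_poly s TypeII (nth 0%N (idxII D) j)) :: l3.
    by rewrite /columns {1}eI {1}eII !map_cat/= -!catA.
  have eD' : columns s (target D (RemoveIII i j)) = l1 ++ l2 ++ l3.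
    by rewrite /columns/= /delete_at !map_cat -!catA.
  have l123 x : x \in l1 ++ l2 ++ l3 -> is_column s x.
    move=> xl; apply: (@columns_is_column s D); rewrite eD.
    move: xl; rewrite (mem_cat x l1) (mem_cat x l2 l3) (mem_cat x l1) inE (mem_cat x l2) inE.
    by case/or3P=> ->; rewrite ?orbT.
  have := remove_identity (@frac_derivM _) (@frac_deriv_tofrac _) tofrac_inj
    n eD eD' sp sq l123 X0.
  rewrite /k -sp -sq => ->; congr (_%:P * _); rewrite /=.
  (* [8 / 4 = 2 * 1 ^+ 2] for Laguerre and [32 / 4 = 2 * 2 ^+ 2] for Jacobi. *)
  by case: s {eD eD' X0 l1 l2 l3 l123} => *; rewrite /=; field.
Qed.
Lemma sumn_set_nth (l : seq nat) j e : (j < size l)%N ->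
  (sumn (set_nth 0%N l j e) + nth 0%N l j = sumn l + e)%N.
Proof.
by move=> jl; rewrite set_nthE jl {4}(take_nth_drop jl) !sumn_cat/=; lia.
Qed.

Lemma sumn_delete_at (l : seq nat) j : (j < size l)%N ->
  (sumn (delete_at j l) + nth 0%N l j = sumn l)%N.
Proof.
by move=> jl; rewrite /delete_at {4}(take_nth_drop jl) !sumn_cat/=; lia.
Qed.

(** The strict drop in degree makes interpolation at the [ell D + n] zeros exact. A replacement
    lowers the bound by the old entry minus [eps]; a removal lowers it by the sum of the two entries
    plus one. *)
Lemma size_P_target s D n m : in_EP D m ->
  (size (P_poly s (target D m) n) <= ell D + n)%N.
Proof.
move=> mD; apply: size_deg_le (P_jet_det s (target D m) n).2 _.
(* The subtractions in [ell] are truncated, which can only enlarge it, so comparison with the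
   integer bound is safe. *)
rewrite /ell -!bin2; have := size_target s mD.
case: m mD => [j e|j e|i j] mD [sp sq].
- have /and3P[jD eD _] := mD; have := sumn_set_nth e jD.
  rewrite sp sq /=; move: eD.
  move: 'C(_, 2) 'C(_, 2) (_ * _)%N (sumn _) (sumn _) (sumn _) (nth _ _ _).
  by clear; lia.
- have /and3P[jD eD _] := mD; have := sumn_set_nth e jD.
  rewrite sp sq /=; move: eD.
  move: 'C(_, 2) 'C(_, 2) (_ * _)%N (sumn _) (sumn _) (sumn _) (nth _ _ _).
  by clear; lia.
- have /andP[iD jD] := mD; have := sumn_delete_at iD; have := sumn_delete_at jD.
  rewrite sp sq !binS !bin1 mulSn mulnS /=; lia.
Qed.
End PolynomialIdentity.

(** * Evaluation at the zeros *)

Lemma clear_denominator (F : fieldType) (X X1 X2 P0 P1 P2 C0 C1 C2 E k Y : F) :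
  X != 0 -> 4 != 0 :> F ->
  C2 * (X * P2) + (C1 * X - 2 * C2 * X1) * P1 + (C2 * X2 - C0 * X1) * P0 + E / 4 * (X * P0)
    = - (k / 4) * Y ->
  X * (- 4 * (C2 * P2 + (C1 - 2 * C2 * (X1 / X)) * P1
     + (C2 * (X2 / X) - C0 * (X1 / X)) * P0) - E * P0) = k * Y.
Proof.
move=> X0 n4 e; transitivity (- 4 * (- (k / 4) * Y)); last by field; exact: n4.
by rewrite -e; field; rewrite X0 n4.
Qed.

Section Evaluation.
Variable R : realType.
Implicit Types (s : system R) (A D : index_pair) (x : R[i]).
Local Notation rc := (real_complex R).

Lemma evalCD (p q : {poly R}) x : evalC (p + q) x = evalC p x + evalC q x.
Proof. by rewrite /evalC rmorphD hornerD. Qed.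

Lemma evalCB (p q : {poly R}) x : evalC (p - q) x = evalC p x - evalC q x.
Proof. by rewrite /evalC rmorphB hornerD hornerN. Qed.

Lemma evalCM (p q : {poly R}) x : evalC (p * q) x = evalC p x * evalC q x.
Proof. by rewrite /evalC rmorphM hornerM. Qed.

Lemma evalC_const (a : R) x : evalC a%:P x = rc a.
Proof. by rewrite /evalC map_polyC hornerC. Qed.

Lemma evalC_nat k x : evalC (k%:R : {poly R}) x = k%:R.
Proof. by rewrite /evalC rmorph_nat -polyC_natr hornerC. Qed.

Lemma Htilde_identity s D n m x : in_EP D m -> evalC (Xi s D) x != 0 ->
  evalC (Xi s D) x
    * (Htilde s D (map_poly rc (P_poly s (target D m) n)) x
       - rc (energyEP s D n m) * evalC (P_poly s (target D m) n) x)
  = rc (coefEP s n m) * evalC (P_poly s D n) x * evalC (Xi s (target D m)) x.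
Proof.
move=> mD X0.
have XN : Xi s D != 0 by apply: contra_neq X0 => ->; rewrite /evalC rmorph0 horner0.
have := congr1 (fun p => evalC p x) (EP_identity n mD XN).
rewrite /= /operator_num !(evalCB, evalCD, evalCM) !evalC_const.
rewrite ?evalC_nat rmorphN !(rmorphM rc) !fmorphV !rmorph_nat.
rewrite /Htilde !derivn_map deriv_map -!/(evalC _ _).
set X := evalC (Xi s D) x in X0 *.
move: (evalC (Xi s D)^`() x) (evalC (Xi s D)^`(2) x) => X1 X2.
move: (evalC (P_poly s _ n) x) (evalC (P_poly s _ n)^`() x) (evalC (P_poly s _ n)^`(2) x).
move=> P0 P1 P2.
move: (evalC (c2 s) x) (evalC (c1 _) x) (evalC (c1 _) x) => C2 C1 C1m.
move=> e; rewrite -[RHS]mulrA; exact: clear_denominator.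
Qed.

Lemma Htilde_sum s D (I : finType) (a : I -> R[i]) (f : I -> {poly R[i]}) x :
  Htilde s D (\sum_i a i *: f i) x = \sum_i a i * Htilde s D (f i) x.
Proof.
rewrite /Htilde; move: (evalC (Xi s D) x) (evalC (Xi s D)^`() x) (evalC (Xi s D)^`(2) x)
  (evalC (c2 s) x) (evalC (c1 _) x) (evalC (c1 _) x) => X0 X1 X2 C2 C1 C0.
rewrite (raddf_sum (derivn 2)) !raddf_sum /= !horner_sum !mulr_sumr -!big_split/= mulr_sumr.
by apply: eq_bigr => i _; rewrite !linearZ/= !hornerZ; ring.
Qed.

Lemma lagrange_interpolation (F : fieldType) r (eta : 'I_r -> F) (p : {poly F}) :
  injective eta -> (size p <= r)%N ->
  p = \sum_m (p.[eta m] / \prod_(j < r | j != m) (eta m - eta j))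
        *: \prod_(j < r | j != m) ('X - (eta j)%:P).
Proof.
move=> eta_inj pr; set S := \sum_m _; apply/eqP; rewrite -subr_eq0; apply/eqP.
have sz m : size (\prod_(j < r | j != m) ('X - (eta j)%:P)) = r.
  rewrite -big_filter size_prod_XsubC size_filter -sum1_count.
  by rewrite (sum1_card (predC1 m)) cardC1 card_ord prednK// (leq_ltn_trans _ (ltn_ord m)).
apply: (@roots_geq_poly_eq0 _ _ [seq eta i | i <- enum 'I_r]).
- apply/allP => _ /mapP[i _ ->]; rewrite rootE hornerD hornerN /S horner_sum (bigD1 i)//=.
  rewrite [X in - (_ + X)]big1 ?addr0.
    rewrite hornerZ horner_prod.
    under [X in _ / _ * X]eq_bigr do rewrite hornerXsubC.
    rewrite divfK ?subrr//; apply/prodf_neq0 => j ji.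
    by rewrite subr_eq0; apply: contra_neq ji => /eta_inj.
  move=> m mi; rewrite hornerZ horner_prod [X in _ * X](bigD1 i) 1?eq_sym//=.
  by rewrite hornerXsubC subrr mul0r mulr0.
- by rewrite map_inj_uniq ?enum_uniq.
- rewrite size_map size_enum_ord; apply: leq_trans (size_polyD _ _) _.
  rewrite geq_max pr size_polyN; apply: leq_trans (size_sum _ _ _) _.
  by apply/bigmax_leqP => m _; apply: leq_trans (size_scale_leq _ _) _; rewrite sz.
Qed.

(** The entries of [eigvec p eta] are the Lagrange coefficients of [p] in the node polynomials that
    define the columns of [Mtilde]. The product thus evaluates the operator on [p] at the nodes, by
    linearity. *)
Lemma Mtilde_eigvec s D n r (eta : 'I_r -> R[i]) (p : {poly R}) :
  injective eta -> (size p <= r)%N ->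
  Mtilde s D n eta *m eigvec p eta
  = \col_i ((Htilde s D (map_poly rc p) (eta i) - rc (energy s n) * evalC p (eta i))
            / \prod_(j < r | j != i) (eta i - eta j)).
Proof.
move=> eta_inj pr; apply/matrixP => i z; rewrite !mxE.
have pC : (size (map_poly rc p) <= r)%N by rewrite size_map_poly.
pose a m := (map_poly rc p).[eta m] / \prod_(j < r | j != m) (eta m - eta j).
pose f m := \prod_(j < r | j != m) ('X - (eta j)%:P).
have E : map_poly rc p = \sum_m a m *: f m := lagrange_interpolation eta_inj pC.
have -> : evalC p (eta i) = \sum_m a m * (f m).[eta i].
  by rewrite /evalC E horner_sum; apply: eq_bigr => m _; rewrite hornerZ.
rewrite [X in Htilde _ _ X]E Htilde_sum mulr_sumr -sumrB mulr_suml.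
apply: eq_bigr => m _; rewrite !mxE -/(f m) /evalC -/(a m).
by ring.
Qed.

Lemma eigvec_neq0 r (eta : 'I_r -> R[i]) (p : {poly R}) :
  injective eta -> (size p <= r)%N -> p != 0 -> eigvec p eta != 0.
Proof.
move=> eta_inj pr; apply: contra_neq => e0.
have pC : (size (map_poly rc p) <= r)%N by rewrite size_map_poly.
apply/eqP; rewrite -(map_poly_eq0 rc) (lagrange_interpolation eta_inj pC).
rewrite big1// => m _; have := congr1 (fun M : 'cV_r => M m 0) e0.
by rewrite !mxE => ->; rewrite scale0r.
Qed.
End Evaluation.

Theorem theorem4p5 (R : realType) (s : system R) (D : index_pair) (n : nat)
    (eta : 'I_(ell D + n) -> R[i])
    (hD : multi_index D) (hs : admissible s D) (hn : (1 <= n)%N)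
    (heta : generic_zeros s D n eta)
    (m : ep_move) (hm : in_EP D m) :
  [/\ Mtilde s D n eta *m eigvec (P_poly s (target D m) n) eta
        = real_complex R (energyEP s D n m - energy s n)
            *: eigvec (P_poly s (target D m) n) eta,
      P_poly s (target D m) n != 0 -> eigvec (P_poly s (target D m) n) eta != 0
    & forall x : R[i], evalC (Xi s D) x != 0 ->
        evalC (Xi s D) x
          * (Htilde s D (map_poly (real_complex R) (P_poly s (target D m) n)) x
             - real_complex R (energyEP s D n m)
                 * evalC (P_poly s (target D m) n) x)
        = real_complex R (coefEP s n m)
            * evalC (P_poly s D n) x * evalC (Xi s (target D m)) x].
Proof.
have [_ eta_inj zeros] := heta; have pr := size_P_target s n hm.
split; last by move=> x; apply: Htilde_identity.
  rewrite Mtilde_eigvec//; apply/matrixP => i z; rewrite !mxE.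
  have [PD0 _ X0] := zeros i.
  (* At a zero of [P_poly s D n] the inhomogeneous right-hand side vanishes while [Xi s D] does not,
     so the target satisfies the eigenvalue equation at the nodes. *)
  have := Htilde_identity n hm X0; rewrite PD0 mulr0 mul0r => /eqP.
  rewrite mulf_eq0 (negPf X0)/= subr_eq0 => /eqP ->.
  by rewrite rmorphB/= -mulrBl mulrA.
exact: eigvec_neq0.
Qed.
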